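(* Let $X$ be a countable (Tychonoff) space with a unique non-isolated point $\infty$. Then $C_p(X)$ is countable dense homogeneous if and only if the filter $\mathcal{N}=\{A\subseteq X\setminus\{\infty\}: A\cup\{\infty\}\text{ is a neighborhood of }\infty\}$ on the countable set $X\setminus\{\infty\}$ is a non-meager $P$-filter.
   Context: For a Tychonoff space $X$, $C_p(X)$ is the space of continuous functions $X\to\mathbb{R}$ with the topology of pointwise convergence (the subspace topology from $\mathbb{R}^X$). A space $Y$ is countable dense homogeneous (CDH) if $Y$ is separable and for any two countable dense subsets $D,E\subseteq Y$ there is a homeomorphism $h\colon Y\to Y$ with $h[D]=E$. A filter $\mathcal{F}$ on a countable set $S$ (identified with $\omega$ via a bijection) is viewed as a subspace of the Cantor set $2^S$ by identifying each set with its characteristic function; $\mathcal{F}$ is non-meager if it is not a meager subset of $2^S$. $\mathcal{F}$ is a $P$-filter if for every countable family $\{F_n:n<\omega\}\subseteq\mathcal{F}$ there is $F\in\mathcal{F}$ with $F\setminus F_n$ finite for every $n$. *)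

(* Defs.v *)
From HB Require Import structures.
From mathcomp Require Import all_boot all_order all_algebra.
From mathcomp Require Import all_classical all_reals all_analysis.
Set Implicit Arguments. Unset Strict Implicit. Unset Printing Implicit Defensive.
Import Order.TTheory GRing.Theory Num.Theory.
Import numFieldTopology.Exports.
Local Open Scope classical_set_scope.

Definition tychonoff_space (X : topologicalType) :=
  accessible_space X /\ completely_regular_space X.

(* C_p(X): continuous real functions with the topology of pointwise convergence,
   i.e. the subspace of {ptws X -> R} = R^X (initial topology of the inclusion). *)
Definition Cp (R : realType) (X : topologicalType) : topologicalType :=
  set_type [set f : {ptws X -> R} | continuous (f : X -> R)].

Definition separable (T : topologicalType) :=
  exists D : set T, countable D /\ dense D.

Definition homeomorphism (T : topologicalType) (h : T -> T) :=
  exists g : T -> T, [/\ cancel h g, cancel g h, continuous h & continuous g].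

Definition countable_dense_homogeneous (T : topologicalType) :=
  separable T /\
  forall D E : set T, countable D -> dense D -> countable E -> dense E ->
    exists h : T -> T, homeomorphism h /\ h @` D = E.

Definition nowhere_dense (T : topologicalType) (A : set T) :=
  interior (closure A) = set0.

Definition meager (T : topologicalType) (A : set T) :=
  exists F : nat -> set T, (forall n, nowhere_dense (F n)) /\
    A `<=` \bigcup_n F n.

Definition as_subset_of_cantor (S : Type) (F : set_system S) : set {ptws S -> bool} :=
  [set chi : {ptws S -> bool} | F [set s | chi s]].

Definition non_meager_family (S : Type) (F : set_system S) :=
  ~ meager (as_subset_of_cantor F).

Definition is_P_filter (S : Type) (F : set_system S) :=
  ProperFilter F /\
  forall Fn : nat -> set S, (forall n, F (Fn n)) ->
    exists2 A, F A & forall n, finite_set (A `\` Fn n).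

Definition punctured (X : topologicalType) (oo : X) : Type := {x : X | x != oo}.

Definition nbhd_filter (X : topologicalType) (oo : X) : set_system (punctured oo) :=
  [set A | nbhs oo ((@proj1_sig _ _) @` A `|` [set oo])].
Arguments nbhd_filter {X} oo.

(* Main.v *)
(* Points of X are numbered by an injection idx : X -> nat with idx oo = 0; a
   function is continuous iff it converges to its value at oo along the
   neighbourhood filter N of oo.

   If N is a non-meager P-filter and D, E are countable dense sets, the P-property
   gives a set A of N along which all members of D and E converge in the ordinary
   sense, and non-meagerness lets A skip infinitely many intervals of indices, so
   that D and E become dense even for uniform approximation on A.  After a
   homeomorphism altering only the value at one isolated point x0, evaluation at
   x0 is injective on D and on E.  A back-and-forth argument then matches D with E
   so that f(x0) |-> e - d extends to a curve psi, with psi_x Lipschitz for every x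
   and 1/2-Lipschitz for x in A and for x = x0, and the shear f |-> f + psi(f(x0))
   is the required homeomorphism.

   Conversely, if N were meager, C_p(X) would be a union of nowhere dense sets T_i,
   and it would have a countable dense set D such that all but finitely many points
   of D have a neighbourhood missing T_i.  A homeomorphism taking D to a set that
   contains the rational constants pulls the T_i back to nowhere dense sets covering
   the line of constants, against Baire.  If N is non-meager, no crowded set of
   eventually constant rational functions is closed in C_p(X); but if N is not a
   P-filter, C_p(X) has a countable closed crowded subset, which can be put into one
   countable dense set while the eventually constant rational functions form
   another. *)
Require Import Defs.
From HB Require Import structures.
From mathcomp Require Import all_boot all_order all_algebra.
From mathcomp Require Import all_classical all_reals all_analysis.
From mathcomp Require Import lra ring zify.
Set Implicit Arguments. Unset Strict Implicit. Unset Printing Implicit Defensive.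
Import Order.TTheory GRing.Theory Num.Theory.
Import numFieldTopology.Exports numFieldNormedType.Exports.
Local Open Scope classical_set_scope.
Local Open Scope ring_scope.

Ltac split_abs :=
  repeat match goal with
  | H : is_true (`|_| < _)%R |- _ => rewrite ltr_norml in H
  | H : is_true (`|_| <= _)%R |- _ => rewrite ler_norml in H
  | H : is_true (_ && _) |- _ => case/andP: H => ? ?
  end.
Ltac abs_lra := split_abs; rewrite ?ltr_norml ?ler_norml; try (apply/andP; split); lra.

(** * Real functions *)

Section RealLemmas.
Variable R : realType.
Implicit Types (e : R).

(** McShane's extension: the infimum of the cones [a i + C * |u - t i|]. Indexing by [I] permits
    repeated abscissae, at which the hypothesis forces equal values. *)
Lemma lipschitz_extension (I : Type) (S : set I) (t a : I -> R) (C : R) :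
  0 <= C -> S !=set0 ->
  (forall i j, S i -> S j -> `|a i - a j| <= C * `|t i - t j|) ->
  exists f : R -> R, (forall i, S i -> f (t i) = a i) /\
    (forall u v, `|f u - f v| <= C * `|u - v|).
Proof.
move=> C0 [i0 Si0] lipa.
pose V u := [set a i + C * `|u - t i| | i in S].
have V0 u : V u !=set0 by exists (a i0 + C * `|u - t i0|), i0.
have Vlb u : has_lbound (V u).
  exists (a i0 - C * `|u - t i0|) => _ [i Si <-].
  have := lipa _ _ Si0 Si => lip.
  have : C * `|t i0 - t i| <= C * `|u - t i0| + C * `|u - t i|.
    rewrite -mulrDr ler_wpM2l//.
    by rewrite (distrC u (t i0)) ler_distD.
  by move: lip; rewrite ler_norml => /andP[? ?] ?; lra.
have Vinf u i : S i -> inf (V u) <= a i + C * `|u - t i|.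
  by move=> Si; apply: ge_inf; [exact: Vlb|exists i].
have half u v : inf (V u) <= inf (V v) + C * `|u - v|.
  rewrite -lerBlDr; apply: lb_le_inf => // _ [i Si <-].
  rewrite lerBlDr -addrA -mulrDr (le_trans (Vinf u _ Si))// lerD2l ler_wpM2l//.
  by rewrite (addrC `|v - _|) ler_distD.
exists (fun u => inf (V u)); split=> [i Si|u v].
  apply/eqP; rewrite eq_le; apply/andP; split.
    by rewrite (le_trans (Vinf _ _ Si))// subrr normr0 mulr0 addr0.
  apply: lb_le_inf => // _ [j Sj <-].
  by have := lipa _ _ Si Sj; rewrite ler_norml => /andP[? ?]; lra.
have h1 := half u v; have := half v u; rewrite (distrC v u) => h2.
by rewrite ler_norml; apply/andP; split; lra.
Qed.

(** The intervals of radius [2 * e j] about [u j] are nested, so the supremum of their left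
    endpoints lies in all of them. *)
Lemma geometric_limit (u e : nat -> R) :
  (forall j, `|u j.+1 - u j| <= e j) -> (forall j, e j.+1 <= e j / 2) ->
  exists l, forall j, `|l - u j| <= 2 * e j.
Proof.
move=> ue ee.
have lo i j : u i - 2 * e i <= u (i + j)%N - 2 * e (i + j)%N.
  elim: j => [|j IH]; first by rewrite addn0.
  rewrite addnS (le_trans IH)//; have := ue (i + j)%N; have := ee (i + j)%N.
  by rewrite ler_norml => ? /andP[? ?]; lra.
have up i j : u (i + j)%N + 2 * e (i + j)%N <= u i + 2 * e i.
  elim: j => [|j IH]; first by rewrite addn0.
  rewrite addnS (le_trans _ IH)//; have := ue (i + j)%N; have := ee (i + j)%N.
  by rewrite ler_norml => ? /andP[? ?]; lra.
have e0 j : 0 <= e j by apply: le_trans (ue j).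
have lu i j : u i - 2 * e i <= u j + 2 * e j.
  case: (leqP i j) => [ij|/ltnW ij].
    have := lo i (j - i)%N; rewrite subnKC// => h; have := e0 j; lra.
  have := up j (i - j)%N; rewrite subnKC// => h; have := e0 i; lra.
have ubV j : ubound (range (fun i => u i - 2 * e i)) (u j + 2 * e j).
  by move=> _ [i _ <-]; exact: lu.
exists (sup (range (fun i => u i - 2 * e i))) => j.
have h1 : u j - 2 * e j <= sup (range (fun i => u i - 2 * e i)).
  by apply: ub_le_sup; [exists (u 0%N + 2 * e 0%N); exact: ubV|exists j].
have h2 : sup (range (fun i => u i - 2 * e i)) <= u j + 2 * e j.
  by apply: ge_sup; [exists (u 0%N - 2 * e 0%N), 0%N|exact: ubV].
by rewrite ler_norml; apply/andP; split; lra.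
Qed.

(** Countable sets are Lebesgue null, whereas the interval []0, e[] is not. *)
Lemma interval_avoid_countable (G : set R) e :
  countable G -> 0 < e -> exists c, [/\ 0 < c, c < e & ~ G c].
Proof.
move=> cG e0; apply: contrapT => nex.
have sub : `]0, e[ `<=` G.
  move=> c; rewrite /= in_itv /= => /andP[c0 ce]; apply: contrapT => nG.
  by apply: nex; exists c.
have c0 : countable `]0, e[%classic by exact: sub_countable (subset_card_le sub) cG.
have := countable_lebesgue_measure0 c0.
by rewrite lebesgue_measure_itv /= lte_fin e0 sube0 => -[] /eqP; rewrite gt_eqF.
Qed.

Lemma lipschitz_real_continuous (f : R -> R) (C : R) :
  (forall u v, `|f u - f v| <= C * `|u - v|) -> continuous f.
Proof.
move=> lipf x; apply/cvgrPdist_lt => e e0.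
have C1 : 0 < `|C| + 1 by rewrite ltr_pwDr.
near=> y; apply: le_lt_trans (lipf _ _) _.
apply: (@le_lt_trans _ _ ((`|C| + 1) * `|x - y|)).
  by rewrite ler_wpM2r// (le_trans (ler_norm C))// lerDl.
rewrite -ltr_pdivlMl//; near: y.
by apply: cvgr_dist_lt; [exact: cvg_id|rewrite mulr_gt0 ?invr_gt0].
Unshelve. all: by end_near. Qed.

Lemma id_add_contraction_inverse (f : R -> R) :
  (forall u v, `|f u - f v| <= 2^-1 * `|u - v|) ->
  exists g : R -> R, [/\ forall u, g u + f (g u) = u,
    forall u, g (u + f u) = u & forall u v, `|g u - g v| <= 2 * `|u - v|].
Proof.
move=> lipf.
have cH : continuous (fun u => u + f u).
  by move=> u; apply: cvgD; [exact: cvg_id|exact: lipschitz_real_continuous lipf _].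
have exH u : exists c, c + f c = u.
  (* Over a distance [M] the value of [f] changes by at most [M / 2 = |f u|], so [c + f c - u] is
     nonpositive at [u - M] and nonnegative at [u + M]. *)
  pose M := 2 * `|f u|.
  have M0 : 0 <= M by rewrite mulr_ge0.
  have ab : u - M <= u + M by lra.
  have := lipf u (u - M); have := lipf u (u + M).
  have -> : u - (u - M) = M by ring.
  have -> : u - (u + M) = - M by ring.
  rewrite normrN (ger0_norm M0) !ler_norml => /andP[h1 h2] /andP[h3 h4].
  have := ler_norm (f u); have := lerNnormlW (lexx `|f u|) => h5 h6.
  have v1 : u - M + f (u - M) <= u by rewrite /M in h1 h2 h3 h4 *; lra.
  have v2 : u <= u + M + f (u + M) by rewrite /M in h1 h2 h3 h4 *; lra.
  have [||c _ <-] := @IVT R (fun u => u + f u) _ _ u ab.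
  - exact: continuous_subspaceT.
  - by rewrite ge_min le_max v1 v2 /= orbT.
  - by exists c.
have [g gP] := choice exH.
have lipg u v : `|g u - g v| <= 2 * `|u - v|.
  have := lipf (g u) (g v); have := ler_normB (u - v) (f (g u) - f (g v)).
  have hu := gP u; have hv := gP v.
  have -> : u - v - (f (g u) - f (g v)) = g u - g v by lra.
  by lra.
exists g; split=> // u.
have := lipf (g (u + f u)) u; have := gP (u + f u).
move=> h1; have -> : f (g (u + f u)) - f u = - (g (u + f u) - u) by lra.
rewrite normrN => h; apply/eqP; rewrite -subr_eq0 -normr_le0; lra.
Qed.

End RealLemmas.

(** * Convergence along a filter and uniform density *)

Lemma uniform_bound (P : nat -> nat -> Prop) :
  (forall i m m', (m <= m')%N -> P i m -> P i m') -> (forall i, exists m, P i m) ->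
  forall k, exists m, forall i, (i <= k)%N -> P i m.
Proof.
move=> mono ex; elim=> [|k [m IH]].
  by have [m Pm] := ex 0%N; exists m => i; rewrite leqn0 => /eqP ->.
have [m' Pm'] := ex k.+1; exists (maxn m m') => i.
rewrite leq_eqVlt => /orP[/eqP ->|ik]; first exact: mono (leq_maxr _ _) Pm'.
exact: mono (leq_maxl _ _) (IH _ ik).
Qed.

Lemma increasing_geq (u : nat -> nat) : (forall k, u k < u k.+1)%N ->
  forall k, (k <= u k)%N.
Proof. by move=> uS; elim=> // k IH; exact: leq_ltn_trans IH (uS k). Qed.

Lemma increasing_mono (u : nat -> nat) : (forall k, u k < u k.+1)%N ->
  forall i j, (i <= j)%N -> (u i <= u j)%N.
Proof.
move=> uS i j /subnKC <-; elim: (j - i)%N => [|k IH]; first by rewrite addn0.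
by rewrite addnS (leq_trans IH)// ltnW.
Qed.

Lemma invS_lt (R : realType) (e : R) : 0 < e ->
  exists k0, forall k, (k0 <= k)%N -> (k.+1%:R : R)^-1 < e.
Proof.
move=> e0; have [k] := ltr_add_invr e0; rewrite add0r => ke; exists k => j kj.
by apply: le_lt_trans ke; rewrite lef_pV2 ?posrE ?ltr0n// ler_nat ltnS.
Qed.

Lemma filter_leq (T : Type) (F : set_system T) (W : nat -> set T) : Filter F ->
  (forall i, F (W i)) -> forall n, F [set x | forall i, (i <= n)%N -> W i x].
Proof.
move=> FF FW; elim=> [|n IH].
  by apply: filterS (FW 0%N) => x Wx i; rewrite leqn0 => /eqP ->.
apply: filterS2 IH (FW n.+1) => x IH Wx i.
by rewrite leq_eqVlt => /predU1P[->//|]; exact: IH.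
Qed.

Section Filter.
Variables (R : realType) (X : choiceType) (oo : X) (idx : X -> nat)
  (N : set_system X).
Implicit Types (f g : X -> R) (A : set X) (e : R).

Definition close_upto n e f g := forall x, (idx x <= n)%N -> `|f x - g x| < e.

Definition converges f := forall e, 0 < e -> N [set x | `|f x - f oo| < e].

Definition converges_along A f := forall e, 0 < e ->
  exists m, forall x, A x -> (m < idx x)%N -> `|f x - f oo| < e.

Definition dense_sequence (d : nat -> X -> R) := forall f, converges f ->
  forall n e, 0 < e -> exists i, close_upto n e f (d i).

(** The target is arbitrary on the indices up to [n] and the constant [g oo] on the part of [A]
    beyond; functions converging along [A] are uniformly close to such targets. *)
Definition uniformly_dense A (d : nat -> X -> R) := forall g n e, 0 < e ->
  exists i, forall x, ((idx x <= n)%N -> `|g x - d i x| < e) /\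
    (A x -> (n < idx x)%N -> `|g oo - d i x| < e).

(** The Talagrand and Jalali-Naini criterion for a filter to be non-meager, in terms of blocks of
    indices. *)
Definition misses_intervals := forall u : nat -> nat, (forall k, u k < u k.+1)%N ->
  exists2 A, N A & forall m, exists2 k, (m <= k)%N &
    forall x, A x -> ~~ (u k < idx x <= u k.+1)%N.

Definition has_pseudointersections := forall V : nat -> set X, (forall n, N (V n)) ->
  exists2 A, N A & forall n, exists m, forall x, A x -> (m < idx x)%N -> V n x.

(** The default entry is the head of [c], which is the value at [oo] once [idx oo = 0]; beyond
    [size c] the function then equals its value at [oo]. *)
Definition step_function (c : seq rat) : X -> R :=
  fun x => ratr (nth (head 0 c) c (idx x)).

Hypothesis idx_inj : injective idx.
Hypothesis idx_oo : idx oo = 0%N.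
Context {FN : Filter N}.
Hypothesis N_tail : forall n, N [set x | x = oo \/ (n < idx x)%N].

Lemma step_function_tail c x : (size c <= idx x)%N ->
  step_function c x = step_function c oo.
Proof. by move=> cx; rewrite /step_function idx_oo nth0 (nth_default _ cx); case: c {cx}. Qed.

Lemma converges_step_function c : converges (step_function c).
Proof.
move=> e e0; apply: filterS (N_tail (size c)) => x /= [->|/ltnW cx].
  by rewrite subrr normr0.
by rewrite step_function_tail// subrr normr0.
Qed.

Lemma step_function_approx f n e : 0 < e -> exists c, forall x,
  ((idx x <= n)%N -> `|f x - step_function c x| < e) /\
  ((n < idx x)%N -> `|f oo - step_function c x| < e).
Proof.
move=> e0.
have exq i : exists q : rat, forall x, idx x = i -> `|f x - ratr q| < e.
  have [[x xi]|nx] := pselect (exists x, idx x = i); last first.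
    by exists 0 => x xi; case: nx; exists x.
  have [|q] := @rat_in_itvoo R (f x - e) (f x + e); first by rewrite ltrBlDr -addrA ltrDl addr_gt0.
  rewrite in_itv /= => /andP[q1 q2]; exists q => y; rewrite -xi => /idx_inj ->.
  by abs_lra.
have [q qP] := choice exq.
exists (mkseq q n.+1) => x; split=> nx.
  by rewrite /step_function nth_mkseq//; exact: qP.
rewrite step_function_tail ?size_mkseq//.
by rewrite /step_function idx_oo nth_mkseq//; exact: qP.
Qed.

Lemma converges_alongW A f : N A -> converges_along A f -> converges f.
Proof.
move=> NA Af e e0; have [m mP] := Af _ e0.
apply: filterS2 NA (N_tail m) => x Ax /= [->|mx]; last exact: mP.
by rewrite subrr normr0.
Qed.

Lemma converges_along_subset A B f : B `<=` A ->
  converges_along A f -> converges_along B f.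
Proof.
by move=> BA Af e /Af[m mP]; exists m => x Bx; apply: mP; exact: BA.
Qed.

Lemma converges_alongD A f g : converges_along A f -> converges_along A g ->
  converges_along A (fun x => f x + g x).
Proof.
move=> Af Ag e e0; have e2 : 0 < e / 2 by rewrite divr_gt0.
have [m mP] := Af _ e2; have [n nP] := Ag _ e2.
exists (maxn m n) => x Ax; rewrite gtn_max => /andP[mx nx].
have := mP x Ax mx; have := nP x Ax nx => ? ?; abs_lra.
Qed.

Lemma converges_alongZ A (k : R) f : converges_along A f ->
  converges_along A (fun x => k * f x).
Proof.
move=> Af e e0; have k1 : 0 < `|k| + 1 by rewrite ltr_wpDl.
have [m mP] := Af (e / (`|k| + 1)) (divr_gt0 e0 k1).
exists m => x Ax mx; rewrite -mulrBr normrM.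
apply: (@le_lt_trans _ _ ((`|k| + 1) * `|f x - f oo|)).
  by rewrite ler_wpM2r// lerDl.
by rewrite -ltr_pdivlMl// mulrC mP.
Qed.

Lemma uniformly_dense_subset A B d : B `<=` A ->
  uniformly_dense A d -> uniformly_dense B d.
Proof.
move=> BA Ad g n e e0; have [i iP] := Ad g n e e0; exists i => x.
by have [h1 h2] := iP x; split=> // Bx; apply: h2; exact: BA.
Qed.

Lemma uniformly_dense_approx A d : uniformly_dense A d ->
  forall f n e, converges_along A f -> 0 < e ->
  exists i, forall x, A x \/ (idx x <= n)%N -> `|f x - d i x| < e.
Proof.
move=> Ad f n e Af e0; have e2 : 0 < e / 2 by rewrite divr_gt0.
have [m mP] := Af _ e2.
have [i iP] := Ad f (maxn m n) _ e2; exists i => x Ax; have [h1 h2] := iP x.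
case: (leqP (idx x) (maxn m n)) => [/h1|mx]; first by move=> ?; lra.
case: Ax => [Ax|xn]; last first.
  by move: mx; rewrite gtn_max => /andP[_]; rewrite ltnNge xn.
have := h2 Ax mx; have := mP x Ax (leq_ltn_trans (leq_maxl _ _) mx) => ? ?.
by abs_lra.
Qed.

Lemma pseudointersection_converges (d : nat -> X -> R) :
  has_pseudointersections -> (forall i, converges (d i)) ->
  exists2 A, N A & forall i, converges_along A (d i).
Proof.
move=> PN dc.
(* The conditions [|d i x - d i oo| < 1/(k+1)] are enumerated through codes of the pairs [(i, k)];
   other codes impose nothing. *)
pose V n := if (unpickle n : option (nat * nat)) is Some (i, k) then
  [set x | `|d i x - d i oo| < k.+1%:R^-1] else setT.
have [n|A NA AP] := PN V.
  rewrite /V; case: unpickle => [[i k]|]; last exact: filterT.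
  by apply: dc; rewrite invr_gt0.
exists A => // i e e0; have [k kP] := invS_lt e0.
have [m mP] := AP (pickle (i, k)); exists m => x Ax mx.
by have := mP x Ax mx; rewrite /V pickleK /= => h; exact: lt_trans h (kP k (leqnn k)).
Qed.

(** The blocks are chosen so that the term of [d] approximating the step function [g j] up to [u k],
    for any [j <= k], is on [A0] within [1/(k+1)] of its limit beyond [u k.+1]. On a set that misses
    the block in between, this term is uniformly close to the target, and non-meagerness provides
    such blocks with [k] arbitrarily large. *)
Lemma exists_uniformly_dense_set (d : nat -> X -> R) :
  misses_intervals -> has_pseudointersections ->
  (forall i, converges (d i)) -> dense_sequence d ->
  exists A, [/\ N A, forall i, converges_along A (d i) & uniformly_dense A d].
Proof.
move=> NM PN dc dd; have [A0 NA0 A0d] := pseudointersection_converges PN dc.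
pose g j := step_function (odflt [::] (unpickle j)).
have gap (k : nat) : 0 < (k.+1%:R : R)^-1 by rewrite invr_gt0.
(* [s (k, n, j)] points to a term of [d] within [1/(k+1)] of [g j] up to index [n]. *)
have /choice[s sP] (t : nat * nat * nat) : exists i,
    close_upto t.1.2 t.1.1.+1%:R^-1 (g t.2) (d i).
  by apply: dd; [exact: converges_step_function|exact: gap].
have /choice[S SP] (t : nat * nat) : exists n', forall j, (j <= t.1)%N ->
    (t.2 < n')%N /\ forall x, A0 x -> (n' < idx x)%N ->
    `|d (s (t, j)) x - d (s (t, j)) oo| < t.1.+1%:R^-1.
  case: t => k n; apply: uniform_bound => [j m m' mm' [nm mP]|j].
    split=> [|x Ax m'x]; first exact: leq_trans mm'.
    by apply: mP => //; exact: leq_ltn_trans m'x.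
  have [m mP] := A0d (s (k, n, j)) _ (gap k); exists (maxn n.+1 m); split.
    exact: leq_maxl.
  by move=> x Ax; rewrite gtn_max => /andP[_ mx]; exact: mP.
pose u := fix u k := if k is k'.+1 then S (k', u k') else 0%N.
have uS k : (u k < u k.+1)%N by have [] := SP (k, u k) 0%N (leq0n _).
have [A1 NA1 A1P] := NM _ uS.
exists (A0 `&` A1); split; first exact: filterI.
  by move=> i; apply: converges_along_subset (A0d i); exact: subIsetl.
move=> f n e e0; have e4 : 0 < e / 4 by rewrite divr_gt0.
have [c cP] := step_function_approx f n e4; have [k0 k0P] := invS_lt e4.
have [k] := A1P (maxn (pickle c) (maxn k0 n)).
rewrite !geq_max => /and3P[ck /k0P ke nk] A1k.
have nu : (n <= u k)%N by exact: leq_trans (increasing_geq uS k).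
have gc : g (pickle c) = step_function c by rewrite /g pickleK.
have := sP (k, u k, pickle c); rewrite gc /= => sk.
have [_] := SP (k, u k) _ ck; move: ke sk => /=.
move: (k.+1%:R^-1 : R) => r ke sk Sk.
exists (s (k, u k, pickle c)) => x; have [c1 c2] := cP x; split=> [xn|[A0x A1x] nx].
  by have := c1 xn; have := sk x (leq_trans xn nu) => ? ?; abs_lra.
case: (leqP (idx x) (u k)) => [xu|ux].
  by have := sk x xu; have := c2 nx => ? ?; abs_lra.
have := A1k x A1x; rewrite ux /= -ltnNge => /(Sk x A0x) h1.
have := sk oo; rewrite idx_oo => /(_ isT) h2.
have [h3 _] := cP oo; move: h3; rewrite idx_oo => /(_ isT) h3.
by abs_lra.
Qed.

End Filter.

(** * Back-and-forth construction of a shear *)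

(** Dependent choice in which a step is available only from states satisfying the invariant. *)
Lemma invariant_choice (T : Type) (Inv : nat -> T -> Prop) (Q : nat -> T -> T -> Prop) s0 :
  Inv 0%N s0 -> (forall n s, Inv n s -> exists s', Inv n.+1 s' /\ Q n s s') ->
  exists s : nat -> T, s 0%N = s0 /\ forall n, Inv n (s n) /\ Q n (s n) (s n.+1).
Proof.
move=> I0 IS.
have /choice[F FP] (p : nat * T) : exists s', Inv p.1 p.2 -> Inv p.1.+1 s' /\ Q p.1 p.2 s'.
  have [/IS[s' sP]|nI] := pselect (Inv p.1 p.2); first by exists s'.
  by exists p.2.
pose s := fix s n := if n is n'.+1 then F (n', s n') else s0.
have Is n : Inv n (s n) by elim: n => // n IH; exact: (FP (n, s n) IH).1.
by exists s; split=> // n; split=> //; exact: (FP (n, s n) (Is n)).2.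
Qed.

Lemma seq_positive_lower_bound (R : realDomainType) (T : eqType) (F : T -> R) (l : seq T) :
  (forall p, p \in l -> 0 < F p) -> exists2 c, 0 < c & forall p, p \in l -> c <= F p.
Proof.
elim: l => [|p l IH] Fl; first by exists 1.
have [|c c0 cP] := IH; first by move=> q ql; apply: Fl; rewrite inE ql orbT.
exists (Num.min c (F p)); first by rewrite lt_min c0 Fl// mem_head.
by move=> q; rewrite inE => /predU1P[->|/cP]; rewrite ge_min ?lexx ?orbT// => ->.
Qed.

Section BackAndForth.
Variables (R : realType).

Definition lipschitz_with (C : R) (f : R -> R) :=
  forall u v, `|f u - f v| <= C * `|u - v|.

Lemma lipschitz_withW C C' f : C <= C' -> lipschitz_with C f -> lipschitz_with C' f.
Proof. by move=> CC fC u v; rewrite (le_trans (fC u v))// ler_wpM2r. Qed.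

Lemma lipschitz_withD C C' f g : lipschitz_with C f -> lipschitz_with C' g ->
  lipschitz_with (C + C') (fun t => f t + g t).
Proof.
move=> fC gC u v; rewrite mulrDl opprD addrACA (le_trans (ler_normD _ _))//.
exact: lerD.
Qed.

Definition bump (r t : R) : R := Num.max 0 (1 - `|t| / r).

Lemma bump0 r : bump r 0 = 1.
Proof. by rewrite /bump normr0 mul0r subr0; apply/max_idPr. Qed.

Lemma bump_eq0 r t : 0 < r -> r <= `|t| -> bump r t = 0.
Proof. by move=> r0 rt; apply/max_idPl; rewrite subr_le0 ler_pdivlMr// mul1r. Qed.

Lemma lipschitz_bump r a : 0 < r -> lipschitz_with r^-1 (fun t => bump r (t - a)).
Proof.
move=> r0 u v; rewrite /bump.
have h : `| `|u - a| / r - `|v - a| / r | <= r^-1 * `|u - v|.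
  rewrite -mulrBl normrM (gtr0_norm (x := r^-1)) ?invr_gt0// mulrC.
  rewrite ler_wpM2l ?invr_ge0 ?(ltW r0)//.
  by rewrite (le_trans (ler_dist_dist _ _))// opprB addrA subrK.
move: (`|u - a| / r) (`|v - a| / r) (r^-1 * `|u - v|) h => p q w.
rewrite ler_norml => /andP[h1 h2].
by rewrite /Num.max; case: ltP => ?; case: ltP => ?;
  rewrite ler_norml; apply/andP; split; lra.
Qed.

Lemma lipschitz_uniform (X : Type) (idx : X -> nat) (F : X -> R -> R) :
  injective idx -> (forall x, exists C, lipschitz_with C (F x)) ->
  forall n, exists2 C, 0 <= C & forall x, (idx x <= n)%N -> lipschitz_with C (F x).
Proof.
move=> idx_inj FL.
have lvl i : exists2 C, 0 <= C & forall x, idx x = i -> lipschitz_with C (F x).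
  have [[x xi]|nx] := pselect (exists x, idx x = i); last first.
    by exists 0 => // x xi; case: nx; exists x.
  have [C xC] := FL x; exists `|C| => // y; rewrite -xi => /idx_inj ->.
  exact: lipschitz_withW (ler_norm C) xC.
elim=> [|n [C C0 CP]].
  by have [C C0 CP] := lvl 0%N; exists C => // x; rewrite leqn0 => /eqP; exact: CP.
have [C' C'0 CP'] := lvl n.+1; exists (C + C'); first exact: addr_ge0.
move=> x; rewrite leq_eqVlt => /orP[/eqP/CP'|/CP]; apply: lipschitz_withW; lra.
Qed.

(** * Finite stages of the matching, and its completion *)

Section Stages.
Variables (X : choiceType) (oo x0 : X) (idx : X -> nat) (A : set X)
  (d e : nat -> X -> R).
Hypotheses (idx_inj : injective idx) (idx_oo : idx oo = 0%N).
Hypotheses (d_conv : forall i, converges_along oo idx A (d i))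
  (e_conv : forall i, converges_along oo idx A (e i)).
Hypotheses (d_dense : uniformly_dense oo idx A d)
  (e_dense : uniformly_dense oo idx A e).

(** The coordinates on which the correction of stage [n] must be small: those in [A], and finitely
    many others, so chosen that every coordinate is eventually included. *)
Let ctl n x := A x \/ (idx x <= idx x0 + n)%N.
Let state := ((R -> X -> R) * seq (nat * nat))%type.

Definition lip_budget n : R := 2^-1 - 2^-1 ^+ n.+1.

(* The shear [f |-> f + s.1 (f x0)] maps [d i] to [e j] for the matched pairs [(i, j)]
   of [s.2].  The Lipschitz budget [lip_budget n] grows to [1/2] so that each stage has
   room for a small correction. *)
Record stage_invariant (n : nat) (s : state) : Prop := StageInvariant {
  stage_match : forall p, p \in s.2 -> forall x, s.1 (d p.1 x0) x = e p.2 x - d p.1 x;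
  stage_lip : forall x, exists C, lipschitz_with C (s.1 ^~ x);
  stage_budget : forall x, ctl 0 x -> lipschitz_with (lip_budget n) (s.1 ^~ x);
  stage_conv : forall t, converges_along oo idx A (s.1 t) }.

Definition stage_extends (n : nat) (s s' : state) :=
  (forall p, p \in s.2 -> p \in s'.2) /\
  forall x, ctl n x -> lipschitz_with (2^-1 ^+ n.+2) (fun t => s'.1 t x - s.1 t x).

Lemma halfX_gt0 n : 0 < 2^-1 ^+ n :> R. Proof. by rewrite exprn_gt0. Qed.

Lemma lip_budgetS n : lip_budget n.+1 = lip_budget n + 2^-1 ^+ n.+2.
Proof. by rewrite /lip_budget !exprS; lra. Qed.

Lemma ctl_mono m n x : (m <= n)%N -> ctl m x -> ctl n x.
Proof. by move=> mn [|xm]; [left|right; rewrite (leq_trans xm)// leq_add2l]. Qed.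

(** The residual [v] of the new pair is added with a tent of radius [r] about [d i x0]. Matched
    values at distance at least [r] are not affected, and the Lipschitz constant of the correction
    at [x] is at most [|v x| / r]. *)
Lemma stage_add_pair n s i j r : stage_invariant n s -> 0 < r ->
  (forall p, p \in s.2 -> r <= `|d p.1 x0 - d i x0|) ->
  (forall x, ctl n x ->
    `|e j x - d i x - s.1 (d i x0) x| <= r * 2^-1 ^+ n.+2) ->
  exists s', [/\ stage_invariant n.+1 s', stage_extends n s s' & (i, j) \in s'.2].
Proof.
move=> sI r0 rP vP; pose v x := e j x - d i x - s.1 (d i x0) x.
have blip C x : `|v x| <= r * C -> lipschitz_with C (fun t => bump r (t - d i x0) * v x).
  move=> vC u w; rewrite -mulrBl normrM.
  apply: (@le_trans _ _ (r^-1 * `|u - w| * (r * C))).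
    by rewrite ler_pM//; exact: lipschitz_bump.
  by rewrite mulrACA mulVf ?gt_eqF// mul1r mulrC.
exists (fun t x => s.1 t x + bump r (t - d i x0) * v x, (i, j) :: s.2); split=> /=.
- split=> /=.
  + move=> p; rewrite inE => /predU1P[-> x|ps x] /=.
      by rewrite subrr bump0 mul1r /v addrC subrK.
    by rewrite (stage_match sI)// bump_eq0 ?mul0r ?addr0// rP.
  + move=> x; have [C sC] := stage_lip sI x.
    exists (C + `|v x| / r); apply: lipschitz_withD sC _; apply: blip.
    by rewrite mulrCA divff ?gt_eqF// mulr1.
  + move=> x x0n; rewrite lip_budgetS; apply: lipschitz_withD.
      exact: (stage_budget sI).
    by apply: blip; apply: vP; exact: ctl_mono x0n.
  + move=> t; apply: converges_alongD (stage_conv sI t) _.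
    apply: converges_alongZ; rewrite /v; apply: converges_alongD.
      apply: converges_alongD => //.
      under eq_fun do rewrite -mulN1r.
      exact: converges_alongZ.
    under eq_fun do rewrite -mulN1r.
    exact: converges_alongZ (stage_conv sI _).
- split=> [p ps|x xn] /=; first by rewrite inE ps orbT.
  by under eq_fun do rewrite addrAC subrr add0r; exact/blip/vP.
- by rewrite inE eqxx.
Qed.

Lemma stage_idle n s : stage_invariant n s -> stage_invariant n.+1 s /\ stage_extends n s s.
Proof.
move=> sI; split; last first.
  by split=> // x _ u v; rewrite !subrr normr0 mulr_ge0//.
split; [exact: stage_match sI|exact: stage_lip sI| |exact: stage_conv sI].
move=> x xn; apply: lipschitz_withW (stage_budget sI xn).
by rewrite lip_budgetS lerDl ltW// halfX_gt0.
Qed.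

(** Uniform density of [e] supplies an [e j] that is close, on the controlled coordinates, to the
    image of [d i] under the current shear, which leaves a small residual. *)
Lemma stage_forth n s i : stage_invariant n s -> exists s',
  [/\ stage_invariant n.+1 s', stage_extends n s s' &
    exists2 p, p \in s'.2 & d p.1 x0 = d i x0].
Proof.
move=> sI; have [[p ps pi]|nold] := pselect (exists2 p, p \in s.2 & d p.1 x0 = d i x0).
  by have [I' E'] := stage_idle sI; exists s; split=> //; exists p.
have [p ps|r r0 rP] := @seq_positive_lower_bound R _
    (fun p => `|d p.1 x0 - d i x0|) s.2.
  by rewrite normr_gt0 subr_eq0; apply/eqP => h; apply: nold; exists p.
have eta0 : 0 < r * 2^-1 ^+ n.+2 by rewrite mulr_gt0 ?halfX_gt0.
have [j jP] := uniformly_dense_approx e_dense (idx x0 + n)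
  (converges_alongD (d_conv i) (stage_conv sI (d i x0))) eta0.
have [|s' [I' E' s'ij]] := stage_add_pair (j := j) sI r0 rP.
  move=> x xn; have := jP x xn; rewrite distrC => /ltW.
  by rewrite opprD addrA.
by exists s'; split=> //; exists (i, j).
Qed.

Lemma lip_budget_half n f : lipschitz_with (lip_budget n) f -> lipschitz_with 2^-1 f.
Proof. by apply: lipschitz_withW; rewrite gerBl ltW// halfX_gt0. Qed.

(** The preimage of [e j] under the current shear is [e j - s.1 u], where [u] is its value at [x0];
    uniform density of [d] supplies a [d i] near it on the controlled coordinates. *)
Lemma stage_back n s j : stage_invariant n s -> exists s',
  [/\ stage_invariant n.+1 s', stage_extends n s s' &
    exists2 p, p \in s'.2 & e p.2 x0 = e j x0].
Proof.
move=> sI; have [[p ps pi]|nold] := pselect (exists2 p, p \in s.2 & e p.2 x0 = e j x0).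
  by have [I' E'] := stage_idle sI; exists s; split=> //; exists p.
have ctl0 : ctl 0 x0 by right; rewrite addn0.
have [g [gP _ _]] := id_add_contraction_inverse (lip_budget_half (stage_budget sI ctl0)).
set u := g (e j x0); have uP : u + s.1 u x0 = e j x0 by exact: gP.
have [p ps|r r0 rP] := @seq_positive_lower_bound R _
    (fun p => `|d p.1 x0 - u|) s.2.
  rewrite normr_gt0 subr_eq0; apply/eqP => h; apply: nold; exists p => //.
  by have := stage_match sI ps x0; rewrite h => h1; rewrite -uP; lra.
have [C C0 CP] := lipschitz_uniform idx_inj (stage_lip sI) (idx x0 + n).
(* The residual has two parts: at most [eta] from approximating the preimage, and at most
   [(C + 1) * eta] from replacing [u] by [d i x0]. The tent has radius [r / 2] because [d i x0] may
   be as far as [r / 2] from [u]. *)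
have C1 : 0 < 1 + (C + 1) by lra.
have r2 : 0 < r / 2 by lra.
pose w := r / 2 * 2^-1 ^+ n.+2.
have w0 : 0 < w by rewrite mulr_gt0 ?halfX_gt0.
have eta0 : 0 < w / (1 + (C + 1)) by rewrite divr_gt0.
have eta1 : w / (1 + (C + 1)) * (1 + (C + 1)) = w by rewrite divfK ?gt_eqF.
have wr : w <= r / 2.
  by rewrite /w ler_piMr ?exprn_ile1 ?invf_le1 ?ler1n// ltW.
move: (w / _) eta0 eta1 => eta eta0 eta1.
have zc : converges_along oo idx A (fun x => e j x - s.1 u x).
  apply: converges_alongD => //; under eq_fun do rewrite -mulN1r.
  exact: converges_alongZ (stage_conv sI _).
have [i iP] := uniformly_dense_approx d_dense (idx x0 + n) zc eta0.
have ctln : A x0 \/ (idx x0 <= idx x0 + n)%N by right; rewrite leq_addr.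
have := iP _ ctln; rewrite -uP addrK => ui.
have eta2 : eta <= r / 2.
  by rewrite (le_trans _ wr)// -eta1 ler_peMr ?ltW//; lra.
have [p ps|x xn|s' [I' E' s'ij]] := stage_add_pair (i := i) (j := j) sI r2.
- have := rP p ps; have := ler_distD (d i x0) (d p.1 x0) u.
  by rewrite (distrC (d i x0) u); lra.
- have lipx : lipschitz_with (C + 1) (s.1 ^~ x).
    case: xn => [Ax|xn]; last by apply: lipschitz_withW (CP x xn); lra.
    apply: lipschitz_withW (lip_budget_half (stage_budget sI (or_introl Ax))); lra.
  have := iP x xn; have := lipx u (d i x0) => h1 h2.
  have -> : e j x - d i x - s.1 (d i x0) x =
    (e j x - s.1 u x - d i x) + (s.1 u x - s.1 (d i x0) x) by ring.
  rewrite (le_trans (ler_normD _ _))// -/w -eta1 mulrDr mulr1.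
  apply: lerD; first exact: ltW.
  by rewrite (le_trans h1)// mulrC ler_wpM2r ?ltW//; lra.
by exists s'; split=> //; exists (i, j).
Qed.

Lemma stages_exist : exists s : nat -> state, forall n,
  [/\ stage_invariant n (s n), stage_extends n (s n) (s n.+1),
    exists2 p, p \in (s n.*2.+1).2 & d p.1 x0 = d n x0 &
    exists2 p, p \in (s n.*2.+2).2 & e p.2 x0 = e n x0].
Proof.
(* Stage [2 i] takes care of [d i], and stage [2 i + 1] of [e i]. *)
pose goal n (s' : state) := if odd n
  then exists2 p, p \in s'.2 & e p.2 x0 = e n./2 x0
  else exists2 p, p \in s'.2 & d p.1 x0 = d n./2 x0.
pose s0 : state := (fun _ _ => 0, [::]).
have I0 : stage_invariant 0 s0.
  split=> //= [x|x _|t r r0]; last by exists 0%N => x _ _; rewrite subrr normr0.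
    by exists 0 => u v; rewrite subrr normr0 mul0r.
  by move=> u v; rewrite /lip_budget expr1 !subrr normr0 mul0r.
have [|s [_ sP]] := @invariant_choice _ stage_invariant
    (fun n s s' => stage_extends n s s' /\ goal n s') _ I0.
  move=> n s sI; rewrite /goal; case: odd.
    by have [s' [? ? ?]] := stage_back n./2 sI; exists s'.
  by have [s' [? ? ?]] := stage_forth n./2 sI; exists s'.
exists s => n; have [sI [sE _]] := sP n; split=> //.
  by have [_ [_]] := sP n.*2; rewrite /goal odd_double doubleK.
by have [_ [_]] := sP n.*2.+1; rewrite /goal /= odd_double /= uphalf_double.
Qed.

(** No limit of the stages is taken. The matched pairs prescribe [psi x] at the numbers [d p.1 x0],
    the stages show these prescriptions to be Lipschitz, and [lipschitz_extension] fills in the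
    rest. *)
Lemma exists_matching : exists (psi : X -> R -> R) (P : set (nat * nat)),
  [/\ forall p, P p -> forall x, psi x (d p.1 x0) = e p.2 x - d p.1 x,
    forall i, exists2 p, P p & d p.1 x0 = d i x0,
    forall j, exists2 p, P p & e p.2 x0 = e j x0,
    forall x, exists C, lipschitz_with C (psi x) &
    forall x, A x \/ (idx x <= idx x0)%N -> lipschitz_with 2^-1 (psi x)].
Proof.
have [s sP] := stages_exist.
have sI n : stage_invariant n (s n) by have [] := sP n.
have sE n : stage_extends n (s n) (s n.+1) by have [] := sP n.
have sub m n p : (m <= n)%N -> p \in (s m).2 -> p \in (s n).2.
  by move=> /subnKC <-; elim: (n - m)%N => [|k IH /IH]; rewrite ?addn0// addnS; apply: (sE _).1.
(* Once [x] is controlled, which happens at stage [idx x] at the latest, all further corrections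
   together add less than 1 to the Lipschitz constant. *)
have grow x m C : ctl m x -> lipschitz_with C ((s m).1 ^~ x) ->
    forall n, lipschitz_with (C + 1 - 2^-1 ^+ n) ((s (m + n)%N).1 ^~ x).
  move=> xm sC; elim=> [|n IH]; first by rewrite addn0 expr0 addrK.
  have := lipschitz_withD IH ((sE (m + n)%N).2 x (ctl_mono (leq_addr _ _) xm)).
  rewrite addnS; under eq_fun do rewrite addrC subrK.
  apply: lipschitz_withW.
  have : 2^-1 ^+ (m + n).+2 <= 2^-1 ^+ n.+1 :> R.
    by apply: ler_wiXn2l; rewrite ?invr_ge0 ?invf_le1 ?ler1n//; lia.
  by rewrite (exprS _ n); move: (_ ^+ n) (_ ^+ (m + n).+2) => y z; lra.
pose P : set (nat * nat) := [set p | exists n, p \in (s n).2].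
pose a (p : nat * nat) x := e p.2 x - d p.1 x.
have plip x C m : (forall n, (m <= n)%N -> lipschitz_with C ((s n).1 ^~ x)) ->
    forall p q, P p -> P q -> `|a p x - a q x| <= C * `|d p.1 x0 - d q.1 x0|.
  move=> sC p q [k pk] [l ql]; pose n := maxn m (maxn k l).
  have := sC n (leq_maxl _ _) (d p.1 x0) (d q.1 x0).
  rewrite !(stage_match (sI n))//.
    by apply: sub ql; rewrite /n; lia.
  by apply: sub pk; rewrite /n; lia.
have [p0 p0P] : exists p, P p.
  by have [_ _ [p ps _] _] := sP 0%N; exists p, 1%N.
have PN0 : P !=set0 by exists p0.
have /choice[psi psiP] x : exists f : R -> R,
    [/\ forall p, P p -> f (d p.1 x0) = a p x, exists C, lipschitz_with C f &
      A x \/ (idx x <= idx x0)%N -> lipschitz_with 2^-1 f].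
  have [xA|xA] := pselect (A x \/ (idx x <= idx x0)%N).
    have h2 : (0 : R) <= 2^-1 by lra.
    have [|f [fP fL]] := @lipschitz_extension R _ P (fun p => d p.1 x0) (a ^~ x) _ h2 PN0.
      apply: (@plip _ _ 0%N) => n _; apply: lip_budget_half (stage_budget (sI n) _).
      by rewrite /ctl addn0.
    by exists f; split=> //; exists 2^-1.
  have [C0 C0P] := stage_lip (sI (idx x)) x.
  have C1 : 0 <= `|C0| + 1 by rewrite addr_ge0.
  have [|f [fP fL]] := @lipschitz_extension R _ P (fun p => d p.1 x0) (a ^~ x) _ C1 PN0.
    apply: (@plip _ _ (idx x)) => n /subnKC <-.
    have xc : ctl (idx x) x by right; rewrite leq_addl.
    apply: lipschitz_withW (grow _ _ _ xc C0P (n - idx x)%N).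
    have := halfX_gt0 (n - idx x)%N; have := ler_norm C0; lra.
  by exists f; split=> //; exists (`|C0| + 1).
exists psi, P; split=> [p Pp x|i|j|x|x]; try by have [] := psiP x.
- by have [h _ _] := psiP x; exact: h.
- by have [_ _ [p ps pi] _] := sP i; exists p => //; exists i.*2.+1.
- by have [_ _ _ [p ps pi]] := sP j; exists p => //; exists j.*2.+2.
Qed.

Definition pointwise_continuous (h : (X -> R) -> X -> R) := forall f n r, 0 < r ->
  exists m q, 0 < q /\ forall g, close_upto idx m q f g -> close_upto idx n r (h f) (h g).

(** The inner [k] lets one statement serve both the shear, with [k = id], and its inverse, where [k]
    recovers the old value at [x0] from the new one. *)
Lemma shear_pointwise_continuous (psi : X -> R -> R) (k : R -> R) K : 0 <= K ->
  lipschitz_with K k -> (forall x, exists C, lipschitz_with C (psi x)) ->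
  pointwise_continuous (fun f x => f x + psi x (k (f x0))).
Proof.
move=> K0 kK psiL f n r r0.
have [C C0 CP] := lipschitz_uniform idx_inj psiL n.
have C1 : 0 < 1 + C * K by rewrite ltr_pwDl// mulr_ge0.
exists (maxn n (idx x0)), (r / (1 + C * K)); split; first exact: divr_gt0.
move=> g fg x xn.
have h1 := fg x (leq_trans xn (leq_maxl _ _)).
have h2 := fg x0 (leq_maxr _ _).
have eq1 : r / (1 + C * K) * (1 + C * K) = r by rewrite divfK ?gt_eqF.
move: (r / _) eq1 h1 h2 => q <- h1 h2.
rewrite opprD addrACA (le_lt_trans (ler_normD _ _))// mulrDr mulr1.
apply: ltr_leD => //; rewrite (le_trans (CP x xn _ _))// mulrCA ler_wpM2l//.
by rewrite (le_trans (kK _ _))// mulrC ler_wpM2r// ltW.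
Qed.

End Stages.
End BackAndForth.

(** * Making a coordinate injective *)

Section Straightening.
Variables (R : realType) (X : choiceType) (idx : X -> nat).
Implicit Types (f g : X -> R).

Definition pointwise_functional (w : (X -> R) -> R) := forall f r, 0 < r ->
  exists m q, 0 < q /\ forall g, close_upto idx m q f g -> `|w f - w g| < r.

(* A continuous function of [f] vanishing iff [f x = a] for some [(x, a)] in [L]. *)
Definition gap_to (L : seq (X * R)) f : R :=
  foldr (fun q acc => Num.min `|f q.1 - q.2| acc) 1 L.

Lemma gap_to_itv L f : 0 <= gap_to L f <= 1.
Proof.
elim: L => [|q L /andP[IH1 IH2]] /=; first by rewrite ler01 lexx.
by rewrite le_min normr_ge0 IH1 ge_min IH2 orbT.
Qed.

Lemma gap_to_gt0 L f : (forall q, q \in L -> f q.1 != q.2) -> 0 < gap_to L f.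
Proof.
elim: L => //= q L IH qL; rewrite lt_min normr_gt0 subr_eq0 qL ?mem_head//=.
by apply: IH => p pL; apply: qL; rewrite inE pL orbT.
Qed.

Lemma gap_to_eq0 L f q : q \in L -> f q.1 = q.2 -> gap_to L f = 0.
Proof.
move=> qL fq; apply/eqP; rewrite eq_le (andP (gap_to_itv L f)).1 andbT.
elim: L qL => //= p L IH; rewrite inE => /predU1P[<-|/IH h]; rewrite ge_min.
  by rewrite fq subrr normr0 lexx.
by rewrite h orbT.
Qed.

Lemma gap_to_functional L : pointwise_functional (gap_to L).
Proof.
move=> f r r0; exists (\max_(q <- L) idx q.1)%N, r; split=> // g.
elim: L => [|q L IH] /=; first by rewrite subrr normr0.
rewrite big_cons => fg.
have h1 : `|f q.1 - g q.1| < r by apply: fg; exact: leq_maxl.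
have h2 : `|gap_to L f - gap_to L g| < r.
  by apply: IH => x xL; apply: fg; rewrite (leq_trans xL)// leq_maxr.
have h3 : `| `|f q.1 - q.2| - `|g q.1 - q.2| | < r.
  by rewrite (le_lt_trans (ler_dist_dist _ _))// opprB addrA subrK.
move: (gap_to L f) (gap_to L g) `|f q.1 - q.2| `|g q.1 - q.2| h2 h3 => a b a' b' h2 h3.
by rewrite /Num.min; case: (ltP a' a) => ?; case: (ltP b' b) => ?; abs_lra.
Qed.

Lemma pointwise_functionalD v w c : pointwise_functional v -> pointwise_functional w ->
  pointwise_functional (fun f => v f + c * w f).
Proof.
move=> vP wP f r r0; have r2 : 0 < r / 2 by lra.
have c1 : 0 < `|c| + 1 by rewrite ltr_wpDl.
have [m [q [q0 mq]]] := vP f _ r2.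
have [m' [q' [q'0 mq']]] := wP f _ (divr_gt0 r2 c1).
exists (maxn m m'), (Num.min q q'); split; first by rewrite lt_min q0.
move=> g fg.
have /mq h1 : close_upto idx m q f g.
  move=> x xm; have := fg x (leq_trans xm (leq_maxl _ _)).
  by rewrite lt_min => /andP[].
have /mq' : close_upto idx m' q' f g.
  move=> x xm; have := fg x (leq_trans xm (leq_maxr _ _)).
  by rewrite lt_min => /andP[].
rewrite ltr_pdivlMr// => h2.
rewrite opprD addrACA -mulrBr (le_lt_trans (ler_normD _ _))// normrM.
have : `|c| * `|w f - w g| <= `|w f - w g| * (`|c| + 1).
  by rewrite mulrC ler_wpM2l// lerDl.
by move: h1 h2; lra.
Qed.

(** The functional is a uniform limit. If [p n] is new, stage [n] adds [c * gap_to L], which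
    vanishes at the earlier terms but not at [p n]. Only countably many [c] are forbidden, and later
    stages leave the value at [p n] fixed. *)
Lemma separating_functional (p : nat -> X -> R) (G : set R) :
  countable G -> (forall r, G r -> G (- r)) ->
  exists2 w, pointwise_functional w & forall i j, G (w (p i) - w (p j)) -> p i = p j.
Proof.
move=> cG GN.
pose Q n (w w' : (X -> R) -> R) := [/\ forall f, `|w' f - w f| <= 2^-1 ^+ n,
  forall i, (i < n)%N -> w' (p i) = w (p i) &
  (forall i, (i < n)%N -> p i <> p n) ->
    forall i, (i < n)%N -> ~ G (w' (p n) - w' (p i))].
have h0 n : 0 < 2^-1 ^+ n :> R by rewrite exprn_gt0.
have [||w [_ wP]] := @invariant_choice _ (fun=> pointwise_functional) Q (fun=> 0).
- by move=> f r r0; exists 0%N, 1; split=> // g _; rewrite subrr normr0.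
- move=> n w wc; have [new|old] := pselect (forall i, (i < n)%N -> p i <> p n); last first.
    by exists w; split=> //; split=> // f; rewrite subrr normr0 ltW.
  have [L Lold Lnew] : exists2 L : seq (X * R),
      forall i, (i < n)%N -> exists2 q, q \in L & p i q.1 = q.2 &
      forall q, q \in L -> p n q.1 != q.2.
    suff H m : (m <= n)%N -> exists2 L : seq (X * R),
        forall i, (i < m)%N -> exists2 q, q \in L & p i q.1 = q.2 &
        forall q, q \in L -> p n q.1 != q.2 by exact: H (leqnn n).
    elim: m => [|m IH] mn; first by exists [::].
    have [L L1 L2] := IH (ltnW mn).
    have [x xmn] : exists x, p m x <> p n x.
      apply: contrapT => nx; apply: (new m mn); apply/funext => x.
      by apply: contrapT => ?; apply: nx; exists x.
    exists ((x, p m x) :: L) => [i|q]; last first.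
      by rewrite inE => /predU1P[-> /=|/L2//]; apply/eqP => /esym.
    rewrite ltnS leq_eqVlt => /predU1P[->|/L1[q qL qi]].
      by exists (x, p m x) => //; rewrite mem_head.
    by exists q => //; rewrite inE qL orbT.
  have b0 := gap_to_gt0 Lnew; set b := gap_to L (p n) in b0.
  (* The values of [c] that would put the corrected difference of the values at [p n] and [p i] into
     [G]. *)
  pose bad i := [set (r - (w (p n) - w (p i))) / b | r in G].
  have cbad : countable (\bigcup_(i in [set: nat]) bad i).
    by apply: bigcup_countable => // i _; exact: sub_countable (card_image_le _ _) cG.
  have [c [c0 c1 cbadN]] := interval_avoid_countable cbad (h0 n).
  exists (fun f => w f + c * gap_to L f); split.
    exact: pointwise_functionalD wc (gap_to_functional L).
  have van i : (i < n)%N -> gap_to L (p i) = 0.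
    by move=> /Lold[q qL qi]; exact: gap_to_eq0 qL qi.
  split=> [f|i /van ->|_ i iltn Gi].
  - rewrite addrAC subrr add0r; have /andP[g0 g1] := gap_to_itv L f.
    rewrite ger0_norm ?mulr_ge0 ?(ltW c0)// (le_trans _ (ltW c1))//.
    by rewrite ler_piMr// ltW.
  - by rewrite mulr0 addr0.
  apply: cbadN; exists i => //; exists (w (p n) + c * b - w (p i)).
    by move: Gi => /=; rewrite (van _ iltn) mulr0 addr0.
  by rewrite opprB addrA subrK addrAC subrr add0r mulfK// gt_eqF.
have /choice[W WP] f : exists l, forall j, `|l - w j f| <= 2 * 2^-1 ^+ j.
  apply: (@geometric_limit R (fun j => w j f) (fun j => 2^-1 ^+ j)) => j.
    by have [_ []] := wP j.
  by rewrite exprS mulrC.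
have small r : 0 < r -> exists n, 4 * 2^-1 ^+ n < r :> R.
  move=> r0; have [k kP] := invS_lt (divr_gt0 r0 (ltr0n R 4)).
  exists k; have := kP k (leqnn k); rewrite ltr_pdivlMr// mulrC.
  apply: le_lt_trans; rewrite ler_wpM2l// exprVn lef_pV2 ?posrE ?exprn_gt0//.
  by rewrite -natrX ler_nat ltn_expl.
exists W.
  move=> f r r0; have [n nr] := small _ (divr_gt0 r0 (ltr0n R 2)).
  have [wc _] := wP n; have r2 : 0 < r / 2 by lra.
  have [m [q [q0 mq]]] := wc f _ r2; exists m, q; split=> // g /mq.
  have := WP f n; have := WP g n; move: (_ ^+ n) nr => z *; abs_lra.
have stable i n : (i < n)%N -> w n (p i) = w i.+1 (p i).
  move=> /subnKC <-; elim: (n - i.+1)%N => [|k IH]; first by rewrite addn0.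
  by rewrite addnS -IH; have [_ [_ st _]] := wP (i.+1 + k)%N; apply: st; rewrite leq_addr.
have Wp i n : (i < n)%N -> W (p i) = w n (p i).
  move=> iltn; rewrite stable//; apply/eqP; rewrite -subr_eq0; apply/eqP.
  apply: contrapT => /eqP; rewrite -normr_gt0 => /small[m mP].
  have := WP (p i) (maxn m i.+1); rewrite (stable i) ?leq_maxr//.
  have : 2^-1 ^+ maxn m i.+1 <= 2^-1 ^+ m :> R.
    by apply: ler_wiXn2l; rewrite ?invr_ge0 ?invf_le1 ?ler1n//; exact: leq_maxl.
  by move: mP (h0 m); move: (_ ^+ m) (_ ^+ maxn _ _) => y z; lra.
(* Differences are kept out of [G] only when a new term appears, so both indices are first replaced
   by first occurrences; symmetry of [G] makes their order irrelevant. *)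
have least i : exists i', p i' = p i /\ forall j, (j < i')%N -> p j <> p i'.
  have [n] := ubnP i; elim: n i => // n IH i; rewrite ltnS => ilen.
  have [[j ji pj]|nj] := pselect (exists2 j, (j < i)%N & p j = p i).
    by have [i' [h1 h2]] := IH j (leq_trans ji ilen); exists i'; split=> //; rewrite h1.
  by exists i; split=> // j ji pj; apply: nj; exists j.
have sep i j : (i < j)%N -> (forall k, (k < j)%N -> p k <> p j) -> ~ G (W (p j) - W (p i)).
  move=> ij newj; rewrite (Wp j j.+1)// (Wp i j.+1) ?(ltn_trans ij)//.
  by have [_ [_ _ new]] := wP j; exact: new.
move=> i j; have [i' [<- newi]] := least i; have [j' [<- newj]] := least j.
case: (ltngtP i' j') => [ij /GN|ji|-> //]; last by move/(sep _ _ ji newi).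
by rewrite opprB => /(sep _ _ ij newj).
Qed.

End Straightening.

(** * Homeomorphisms between dense sequences *)

Section Homogeneity.
Variables (R : realType) (X : choiceType) (oo x0 : X) (idx : X -> nat)
  (N : set_system X).
Hypotheses (idx_inj : injective idx) (idx_oo : idx oo = 0%N) (x0_oo : x0 != oo).
Context {FN : Filter N}.
Hypothesis N_tail : forall n, N [set x | x = oo \/ (n < idx x)%N].
Implicit Types (f : X -> R) (d e : nat -> X -> R).

Definition converging_homeo (h g : (X -> R) -> X -> R) :=
  [/\ cancel h g /\ cancel g h, pointwise_continuous idx h, pointwise_continuous idx g,
    forall f, converges oo N f -> converges oo N (h f) &
    forall f, converges oo N f -> converges oo N (g f)].

Lemma converging_homeo_sym h g : converging_homeo h g -> converging_homeo g h.
Proof. by case=> -[]. Qed.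

Lemma converging_homeo_comp h g h' g' : converging_homeo h g ->
  converging_homeo h' g' -> converging_homeo (h' \o h) (g \o g').
Proof.
have pc (u v : (X -> R) -> X -> R) : pointwise_continuous idx u ->
    pointwise_continuous idx v -> pointwise_continuous idx (v \o u).
  move=> uc vc f n r r0; have [m [q [q0 mq]]] := vc (u f) n r r0.
  have [m' [q' [q'0 mq']]] := uc f m q q0; exists m', q'; split=> // g0 /mq'.
  exact: mq.
move=> [[h1 h2] h3 h4 h5 h6] [[g1 g2] g3 g4 g5 g6]; split.
- by split; apply: can_comp.
- exact: pc.
- exact: pc.
- by move=> f /h5/g5.
- by move=> f /g6/h6.
Qed.

Lemma dense_sequence_homeo h g d : converging_homeo h g ->
  dense_sequence oo idx N d -> dense_sequence oo idx N (h \o d).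
Proof.
move=> [[_ gh] hc _ _ gconv] dd f fc n r r0.
have [m [q [q0 mq]]] := hc (g f) n r r0.
have [i id] := dd _ (gconv f fc) m q q0; exists i.
by have := mq _ id; rewrite gh.
Qed.

(** [shift] changes only the value at [x0], by an amount computed from the other values, so
    subtracting this amount inverts it. *)
Let erase f : X -> R := fun x => if x == x0 then 0 else f x.
Let shift (w : (X -> R) -> R) f : X -> R :=
  fun x => if x == x0 then f x + w (erase f) else f x.

Lemma erase_shift w f : erase (shift w f) = erase f.
Proof. by apply/funext => x; rewrite /erase /shift; case: eqP. Qed.

Lemma shift_homeo w : pointwise_functional idx w ->
  converging_homeo (shift w) (shift (fun f => - w f)).
Proof.
have can1 v : cancel (shift v) (shift (fun f => - v f)).
  move=> f; apply/funext => x; rewrite {1}/shift erase_shift /shift.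
  by case: eqP => // _; rewrite addrK.
have pc v : pointwise_functional idx v -> pointwise_continuous idx (shift v).
  move=> vc f n r r0; have r2 : 0 < r / 2 by lra.
  have [m [q [q0 mq]]] := vc (erase f) _ r2.
  exists (maxn n m), (Num.min q (r / 2)); split; first by rewrite lt_min q0.
  move=> g fg x xn; have := fg x (leq_trans xn (leq_maxl _ _)).
  rewrite lt_min => /andP[_ h1]; rewrite /shift; case: eqP => [_|_]; last by lra.
  have := mq (erase g); have : close_upto idx m q (erase f) (erase g).
    move=> y ym; rewrite /erase; case: eqP => _; first by rewrite subrr normr0.
    by have := fg y (leq_trans ym (leq_maxr _ _)); rewrite lt_min => /andP[].
  by move=> h /(_ h); move: (v _) (v _) => *; abs_lra.
have conv v f : converges oo N f -> converges oo N (shift v f).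
  move=> fc r r0; apply: filterS2 (fc r r0) (N_tail (idx x0)) => x /= fx xx.
  rewrite {2}/shift eq_sym (negPf x0_oo) /shift; case: eqP => // xx0.
  by case: xx => [xo|]; [case/eqP: x0_oo; rewrite -xx0|rewrite xx0 ltnn].
move=> wc; split; [|exact: pc| |exact: conv|exact: conv].
  split; first exact: can1.
  move=> f; have := can1 (fun f => - w f) f.
  by rewrite (_ : (fun f => - - w f) = w)//; apply/funext => g; rewrite opprK.
apply: pc => f r r0; have [m [q [q0 mq]]] := wc f r r0.
by exists m, q; split=> // g /mq; rewrite -opprD normrN.
Qed.

(** If the images of [d i] and [d j] agree at [x0], their corrections differ by an element of [G].
    Hence [d i] and [d j] agree off [x0], so the corrections coincide and the values at [x0] agree
    too. *)
Lemma straighten d : exists h g, converging_homeo h g /\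
  forall i j, h (d i) x0 = h (d j) x0 -> d i = d j.
Proof.
pose G := range (fun p : nat * nat => d p.1 x0 - d p.2 x0).
have cG : countable G by exact: sub_countable (card_image_le _ _) (countableP _).
have [|w wc wP] := separating_functional idx (fun i => erase (d i)) cG.
  by move=> _ [[i j] _ <-]; exists (j, i); rewrite //= opprB.
exists (shift w), (shift (fun f => - w f)); split; first exact: shift_homeo.
move=> i j; rewrite /shift eqxx => eqij.
have eqe : erase (d i) = erase (d j) by apply: wP; exists (j, i) => //=; lra.
apply/funext => x; have := congr1 (@^~ x) eqe; rewrite /erase.
by case: eqP => [->|//] _; move: eqij; rewrite eqe => /addIr.
Qed.

Lemma shear_homeo A d e :
  N A -> (forall i, converges_along oo idx A (d i)) ->
  (forall i, converges_along oo idx A (e i)) ->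
  uniformly_dense oo idx A d -> uniformly_dense oo idx A e ->
  (forall i j, d i x0 = d j x0 -> d i = d j) ->
  (forall i j, e i x0 = e j x0 -> e i = e j) ->
  exists h g, [/\ converging_homeo h g, forall i, exists j, h (d i) = e j &
    forall j, exists i, h (d i) = e j].
Proof.
move=> NA dc ec dd ed d_inj e_inj.
have [psi [P [psiP Pd Pe psiL psi2]]] := exists_matching x0 idx_inj idx_oo dc ec dd ed.
have lip0 : lipschitz_with 2^-1 (psi x0) by apply: psi2; right.
have [k [k1 k2 kL]] := id_add_contraction_inverse lip0.
(* At [t = d p.1 x0] this function is [e p.2 - d p.1], which converges along [A]. Such [t] are dense
   in the line and the [1/2]-Lipschitz bound is uniform on [A] and at [oo], so convergence passes to
   every [t]. *)
have psi_conv t : converges oo N (psi ^~ t).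
  apply: converges_alongW NA _ => // r r0.
  have r3 : 0 < r / 3 by lra.
  have [i iP] := dd (fun=> t) (idx x0) _ r3.
  have [ti _] := iP x0; have {ti} := ti (leqnn _).
  have [p Pp <-] := Pd i => ti.
  have [m mP] : exists m, forall x, A x -> (m < idx x)%N ->
      `|psi x (d p.1 x0) - psi oo (d p.1 x0)| < r / 3.
    have [m mP] := converges_alongD (ec p.2) (converges_alongZ (-1) (dc p.1)) r3.
    by exists m => x Ax mx; rewrite !psiP//; have := mP x Ax mx; rewrite !mulN1r.
  exists m => x Ax mx; have := mP x Ax mx.
  have := psi2 oo; rewrite idx_oo => /(_ (or_intror (leq0n _)) t (d p.1 x0)).
  have := psi2 x (or_introl Ax) t (d p.1 x0).
  by move: ti; move: `|t - _| => z *; abs_lra.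
have convD f g : converges oo N f -> converges oo N g -> converges oo N (fun x => f x + g x).
  move=> fc gc r r0; have r2 : 0 < r / 2 by lra.
  by apply: filterS2 (fc _ r2) (gc _ r2) => x /= *; abs_lra.
pose h f x := f x + psi x (f x0); pose g f x := f x + - psi x (k (f x0)).
have hd p : P p -> h (d p.1) = e p.2.
  by move=> Pp; apply/funext => x; rewrite /h psiP// addrC subrK.
exists h, g; split.
- split.
  + split=> f; apply/funext => x; rewrite /h /g; first by rewrite k2 addrK.
    have -> : f x0 - psi x0 (k (f x0)) = k (f x0) by rewrite -{1}(k1 (f x0)) addrK.
    by rewrite subrK.
  + apply: (@shear_pointwise_continuous R X x0 idx idx_inj psi id 1) => //.
    by move=> u v; rewrite mul1r.
  + apply: (@shear_pointwise_continuous R X x0 idx idx_inj (fun x t => - psi x t) k 2) => //.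
    move=> x; have [C CP] := psiL x; exists C => u v.
    by rewrite -opprD normrN.
  + by move=> f fc; exact: convD.
  + move=> f fc; apply: convD => // r r0; apply: filterS (psi_conv (k (f x0)) r r0) => x /=.
    by rewrite -opprD normrN.
- move=> i; have [p Pp /d_inj <-] := Pd i; exists p.2; exact: hd.
- by move=> j; have [p Pp /e_inj <-] := Pe j; exists p.1; exact: hd.
Qed.

Theorem dense_sequences_homeo d e :
  misses_intervals idx N -> has_pseudointersections idx N ->
  (forall i, converges oo N (d i)) -> (forall i, converges oo N (e i)) ->
  dense_sequence oo idx N d -> dense_sequence oo idx N e ->
  exists h g, [/\ converging_homeo h g, forall i, exists j, h (d i) = e j &
    forall j, exists i, h (d i) = e j].
Proof.
move=> NM PN dc ec dd ed.
have [u [u' [uh ud]]] := straighten d; have [v [v' [vh ve]]] := straighten e.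
have uc i : converges oo N ((u \o d) i) by case: uh => _ _ _ h _; exact: h.
have vc i : converges oo N ((v \o e) i) by case: vh => _ _ _ h _; exact: h.
have [A [NA Ac Ad]] := exists_uniformly_dense_set idx_inj idx_oo N_tail NM PN uc
  (dense_sequence_homeo uh dd).
have [B [NB Bc Be]] := exists_uniformly_dense_set idx_inj idx_oo N_tail NM PN vc
  (dense_sequence_homeo vh ed).
have [h [g [hg hd he]]] : exists h g, [/\ converging_homeo h g,
    forall i, exists j, h ((u \o d) i) = (v \o e) j &
    forall j, exists i, h ((u \o d) i) = (v \o e) j].
  apply: (@shear_homeo (A `&` B)).
  - exact: filterI.
  - by move=> i; apply: converges_along_subset (Ac i); exact: subIsetl.
  - by move=> i; apply: converges_along_subset (Bc i); exact: subIsetr.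
  - by apply: uniformly_dense_subset Ad; exact: subIsetl.
  - by apply: uniformly_dense_subset Be; exact: subIsetr.
  - by move=> i j /ud /= ->.
  - by move=> i j /ve /= ->.
exists (v' \o (h \o u)), ((u' \o g) \o v); split.
- exact: converging_homeo_comp (converging_homeo_comp uh hg) (converging_homeo_sym vh).
- move=> i; have [j /= hj] := hd i; exists j; rewrite /= hj.
  by case: vh => -[vK _] _ _ _ _; exact: vK.
- move=> j; have [i /= hi] := he j; exists i; rewrite /= hi.
  by case: vh => -[vK _] _ _ _ _; exact: vK.
Qed.

End Homogeneity.

(** * Crowded sets of eventually constant functions *)

Lemma increasing_bracket (u : nat -> nat) k0 y : (forall k, u k < u k.+1)%N ->
  (u k0 < y)%N -> exists2 k, (k0 <= k)%N & (u k < y <= u k.+1)%N.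
Proof.
move=> uS k0y.
have [k ky kmin] := ex_minnP (ex_intro (fun k => y <= u k)%N y (increasing_geq uS y)).
have k0k : (k0 < k)%N.
  by rewrite ltnNge; apply/negP => /(increasing_mono uS); lia.
case: k ky kmin k0k => // k ky kmin; rewrite ltnS => k0k; exists k => //.
rewrite ky andbT ltnNge; apply/negP => /kmin; lia.
Qed.

Section Escape.
Variables (R : realType) (X : choiceType) (oo : X) (idx : X -> nat)
  (N : set_system X) (q : nat -> X -> R).
Hypothesis idx_oo : idx oo = 0%N.
Context {FN : Filter N}.
Hypothesis N_tail : forall n, N [set x | x = oo \/ (n < idx x)%N].
Hypothesis q_tail : forall i, exists n, forall x, (n < idx x)%N -> q i x = q i oo.
Hypothesis q_crowded : forall i n r, 0 < r ->
  exists2 j, q j <> q i & close_upto idx n r (q i) (q j).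

Let state := (nat * nat * R)%type.

(* A stage [(m, n, r)] looks at [q 0, ..., q m] on the points of index at most [n],
   where they are separated by [8 r] and beyond which they are constant. *)
Let inv k (s : state) := [/\ (k <= s.1.1)%N, (k <= s.1.2)%N, 0 < s.2,
  s.2 <= k.+1%:R^-1 &
  (forall i, (i <= s.1.1)%N -> forall x, (s.1.2 < idx x)%N -> q i x = q i oo) /\
  forall i j, (i <= s.1.1)%N -> (j <= s.1.1)%N -> q i <> q j ->
    exists2 x, (idx x <= s.1.2)%N & 8 * s.2 <= `|q i x - q j x|].

Let step (k : nat) (s s' : state) := [/\ (s.1.1 <= s'.1.1)%N, (s.1.2 < s'.1.2)%N,
  s'.2 <= s.2 / 2 & forall i, (i <= s.1.1)%N ->
    exists j, [/\ (j <= s'.1.1)%N, q j <> q i & close_upto idx s.1.2 s.2 (q i) (q j)]].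

Let inv_exists k m n0 r0 : (k <= m)%N -> (k <= n0)%N -> 0 < r0 ->
  exists n r, [/\ (n0 <= n)%N, r <= r0 & inv k (m, n, r)].
Proof.
move=> km kn r00.
have [n1 n1P] := @uniform_bound (fun i n => forall x, (n < idx x)%N -> q i x = q i oo)
  (fun i n n' nn h x nx => h x (leq_ltn_trans nn nx)) q_tail m.
have /choice[wx wxP] (p : nat * nat) : exists x, q p.1 <> q p.2 -> q p.1 x <> q p.2 x.
  have [eqq|neq] := pselect (q p.1 = q p.2); first by exists oo.
  apply: contrapT => nx; apply: neq; apply/funext => x; apply: contrapT => ?.
  by apply: nx; exists x.
pose L := [seq p <- [seq (i, j) | i <- iota 0 m.+1, j <- iota 0 m.+1] | `[< q p.1 <> q p.2 >]].
have [p|c c0 cP] := @seq_positive_lower_bound R _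
    (fun p => `|q p.1 (wx p) - q p.2 (wx p)|) L.
  rewrite mem_filter => /andP[/asboolP/wxP h _].
  by rewrite normr_gt0 subr_eq0; apply/eqP.
pose r := Num.min r0 (Num.min (k.+1%:R^-1) (c / 8)).
exists (maxn n0 (maxn n1 (\max_(p <- L) idx (wx p)))), r; split.
- exact: leq_maxl.
- by rewrite ge_min lexx.
split=> //=; first by rewrite (leq_trans kn)// leq_maxl.
- by rewrite !lt_min r00 invr_gt0 ltr0n/= divr_gt0.
- by rewrite !ge_min lexx orbT.
split=> [i im x|i j im jm qij]; first by rewrite !gtn_max => /and3P[_ h _]; exact: n1P.
have ijL : (i, j) \in L.
  rewrite mem_filter; apply/andP; split; first exact/asboolP.
  by apply/allpairsP; exists (i, j); rewrite !mem_iota !add0n !ltnS.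
exists (wx (i, j)).
  rewrite !leq_max; apply/orP; right; apply/orP; right.
  exact: (leq_bigmax_seq (F := fun p => idx (wx p)) _ ijL).
have /= := cP _ ijL; have : r <= c / 8 by rewrite !ge_min lexx !orbT.
lra.
Qed.

Let step_exists k s : inv k s -> exists s', inv k.+1 s' /\ step k s s'.
Proof.
case: s => -[m n] r [/= km kn r0 rk [tl sep]].
have [m' m'P] := @uniform_bound (fun i m' => exists j, [/\ (j <= m')%N, q j <> q i &
    close_upto idx n r (q i) (q j)])
  (fun i m m' mm => fun '(ex_intro j (And3 h1 h2 h3)) =>
     ex_intro _ j (And3 (leq_trans h1 mm) h2 h3))
  (fun i => let: ex_intro2 j h1 h2 := q_crowded i n r0 in
     ex_intro _ j (ex_intro _ j (And3 (leqnn j) h1 h2))) m.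
have r2 : 0 < r / 2 by lra.
have h1 : (k.+1 <= maxn m.+1 m')%N by lia.
have h2 : (k.+1 <= n.+1)%N by lia.
have [n1 [r1 [nn1 r1r I1]]] := inv_exists h1 h2 r2.
exists (maxn m.+1 m', n1, r1); split=> //; split=> //=.
  by rewrite (leq_trans (leqnSn m))// leq_maxl.
move=> i /m'P[j [jm' qij cij]]; exists j; split=> //.
by rewrite (leq_trans jm')// leq_maxr.
Qed.

(** Follow [q (t k)], where [t] moves to a different nearby function exactly at the stages whose
    block of indices is missed by [A]. Infinitely many moves keep the limit away from each [q j],
    and the absence of moves on blocks that [A] meets makes it converge. *)
Lemma escaping_limit : misses_intervals idx N ->
  exists f, [/\ converges oo N f,
    forall n r, 0 < r -> exists i, close_upto idx n r f (q i) &
    forall i, f <> q i].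
Proof.
move=> NM.
have [n0 [r0 [_ _ I0]]] := inv_exists (leqnn 0%N) (leqnn 0%N) ltr01.
have [s [_ sP]] := invariant_choice I0 step_exists.
have sI k : inv k (s k) by have [] := sP k.
have sS k : step k (s k) (s k.+1) by have [] := sP k.
pose m k := (s k).1.1; pose n k := (s k).1.2; pose r k := (s k).2.
have nS k : (n k < n k.+1)%N by have [] := sS k.
have r_gt0 k : 0 < r k by have [] := sI k.
have rS k : r k.+1 <= r k / 2 by have [] := sS k.
have /choice[nxt nxtP] (p : nat * nat) : exists j, (p.2 <= m p.1)%N ->
    [/\ (j <= m p.1.+1)%N, q j <> q p.2 & close_upto idx (n p.1) (r p.1) (q p.2) (q j)].
  have [pm|pm] := pselect (p.2 <= m p.1)%N; last by exists 0%N.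
  by have [_ _ _ /(_ _ pm)[j jP]] := sS p.1; exists j.
have [A NA AP] := NM n nS.
pose good k := forall x, A x -> ~~ (n k < idx x <= n k.+1)%N.
pose t := fix t k := if k is k'.+1
  then if `[< good k' >] then nxt (k', t k') else t k' else 0%N.
have tS k : t k.+1 = if `[< good k >] then nxt (k, t k) else t k by [].
have tm k : (t k <= m k)%N.
  elim: k => // k IH; rewrite tS; case: asboolP => _.
    by have [] := nxtP (k, t k) IH.
  by rewrite (leq_trans IH)//; have [] := sS k.
have tstep k x : (idx x <= n k)%N -> `|q (t k.+1) x - q (t k) x| <= r k.
  move=> xn; rewrite tS; case: asboolP => _; last by rewrite subrr normr0 ltW.
  by have [_ _ h] := nxtP (k, t k) (tm k); rewrite distrC ltW// h.
have /choice[f fP0] x : exists l, forall j,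
    `|l - q (t (idx x + j)%N) x| <= 2 * r (idx x + j)%N.
  apply: (@geometric_limit R (fun j => q (t (idx x + j)%N) x)
    (fun j => r (idx x + j)%N)) => j; last by rewrite addnS.
  by rewrite addnS tstep// (leq_trans (leq_addr j _))// increasing_geq.
have fP x k : (idx x <= n k)%N -> `|f x - q (t k) x| <= 2 * r k.
  have [l] : exists l, (idx x <= k + l)%N by exists (idx x); rewrite leq_addl.
  elim: l k => [|l IH] k xk xn.
    by move: xk; rewrite addn0 => /subnKC <-.
  have := IH k.+1; rewrite addSnnS => /(_ xk (leq_trans xn (ltnW (nS k)))).
  by have := tstep k x xn; have := rS k => *; abs_lra.
have rle k : r k <= k.+1%:R^-1 by have [] := sI k.
exists f; split.
- move=> e e0; have e4 : 0 < e / 4 by lra.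
  have [k0 k0P] := invS_lt e4.
  apply: filterS2 NA (N_tail (n k0)) => x Ax /= [->|nx].
    by rewrite subrr normr0.
  (* The block containing [idx x] is met by [A], so [t] does not move there, and [q (t k)] already
     takes its value at [oo] on this block. *)
  have [k k0k xk] := increasing_bracket nS nx.
  have tk : t k.+1 = t k.
    by rewrite tS; case: asboolP => // /(_ x Ax); rewrite xk.
  have /andP[xk1 xk2] := xk.
  have := fP x k.+1 xk2; rewrite tk.
  have [_ _ _ _ [-> // _]] := sI k.
  have := fP oo k; rewrite idx_oo => /(_ (leq0n _)).
  have := rS k; have := rle k; have := k0P k k0k; have := r_gt0 k.
  by move: (_^-1) => z *; abs_lra.
- move=> n1 e e0; have e2 : 0 < e / 2 by lra.
  have [k0 k0P] := invS_lt e2; exists (t (maxn n1 k0)) => x xn.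
  apply: le_lt_trans (fP x _ _) _.
    by rewrite (leq_trans xn)// (leq_trans (leq_maxl n1 k0))// increasing_geq.
  rewrite mulrC -ltr_pdivlMr// (le_lt_trans (rle _))// k0P// leq_maxr//.
move=> j fj.
(* The limit is within [2 * r k] of [q (t k)] up to [n k], while distinct functions among the first
   ones differ by [8 * r k] there. A limit equal to [q j] would thus equal [q (t k)] for all
   [k >= j], against the move at the next good stage. *)
have away k i : (i <= m k)%N -> (j <= k)%N -> i = t k -> q i = q j.
  move=> im jk it; apply: contrapT => qij.
  have jm : (j <= m k)%N by have [h _ _ _ _] := sI k; exact: leq_trans h.
  have [_ _ _ _ [_ /(_ i j im jm qij)[x xn]]] := sI k.
  have := fP x k xn; rewrite -it fj distrC; have := r_gt0 k.
  by clear fj it qij; rewrite /r; move: `|_| => *; lra.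
have [k jk gk] := AP j.
have [h1 h2 _] := nxtP (k, t k) (tm k).
have tk1 : t k.+1 = nxt (k, t k) by rewrite tS; case: asboolP.
apply: h2; rewrite (away k.+1 _ h1 (leqW jk))// /=.
by rewrite (away k (t k)).
Qed.

End Escape.

(** * A closed crowded set from the failure of the P-property *)

Section Levels.
Variables (X : choiceType) (oo : X) (idx : X -> nat) (N : set_system X).
Hypothesis idx_oo : idx oo = 0%N.
Context {FN : Filter N}.
Hypothesis N_tail : forall n, N [set x | x = oo \/ (n < idx x)%N].

(** By the last clause, the sets of points of level at least [i], together with [oo], form a
    sequence in [N] without pseudointersection in [N]. *)
Definition levels (lev : X -> nat) := [/\
  forall i, N [set x | x = oo \/ (i <= lev x)%N],
  forall i m, exists2 x, lev x = i & (m < idx x)%N &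
  forall U, N U -> exists n, forall m, exists x, [/\ U x, (m < idx x)%N & (lev x < n)%N]].

(** The levels are the successive differences of a decreasing sequence [B] in [N]. Since [B k] is
    not a pseudointersection of [V], infinitely many of its points lie outside some [V n];
    intersecting with that [V n] makes the level infinite. *)
Lemma levels_exist : ~ has_pseudointersections idx N -> exists lev, levels lev.
Proof.
move=> /existsNP[V /not_implyP[NV nU]].
have noU U : N U -> exists n, forall m, exists x, [/\ U x, (m < idx x)%N & ~ V n x].
  move=> UN; apply: contrapT => nex; apply: nU; exists U => // n.
  apply: contrapT => nm; apply: nex; exists n => m; apply: contrapT => nx.
  apply: nm; exists m => x Ux mx; apply: contrapT => nV; apply: nx.
  by exists x; split.
(* Removing the indices up to [k] makes every point other than [oo] leave [B] at some stage, so that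
   its level is defined. *)
pose W k : set X := V k `&` [set x | x = oo \/ (k < idx x)%N].
have NW k : N (W k) by exact: filterI.
pose inv k (B : set X) := N B /\ forall j, (j < k)%N -> B `<=` W j.
pose step (k : nat) (B B' : set X) := B' `<=` B /\
  forall m, exists x, [/\ (m < idx x)%N, B x & ~ B' x].
have [||B [B0 BP]] := @invariant_choice _ inv step setT.
- by split=> //; exact: filterT.
- move=> k B [NB BW]; have [n nP] := noU B NB.
  exists (B `&` [set x | forall i, (i <= maxn n k)%N -> W i x]); split.
    split; first by apply: filterI => //; exact: filter_leq.
    by move=> j jk x [_]; apply; rewrite leq_max -(ltnS j k) jk orbT.
  split=> [|m]; first exact: subIsetl.
  have [x [Bx mx nV]] := nP m; exists x; split=> // -[_ h].
  by apply: nV; have [] := h n (leq_maxl _ _).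
have Bmono i j : (i <= j)%N -> B j `<=` B i.
  move=> /subnKC <-; elim: (j - i)%N => [|k IH]; first by rewrite addn0.
  by rewrite addnS => x Bx; apply: IH; have [_ [h _]] := BP (i + k)%N; exact: h.
have NB i : N (B i) by have [[]] := BP i.
have /choice[lev levP] x : exists i, x <> oo -> B i x /\ ~ B i.+1 x.
  have [->|xoo] := pselect (x = oo); first by exists 0%N.
  have nB : ~ B (idx x).+1 x.
    have [[_ h] _] := BP (idx x).+1.
    by move=> /(h _ (leqnn _))[_ [//|]]; rewrite ltnn.
  apply: contrapT => nex; apply: nB; elim: (idx x).+1 => [|k IH]; first by rewrite B0.
  by apply: contrapT => nB; apply: nex; exists k.
have levE i x : x <> oo -> B i x -> ~ B i.+1 x -> lev x = i.
  move=> /levP[h1 h2] h3 h4; apply/eqP; rewrite eqn_leq; apply/andP; split.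
    by rewrite leqNgt; apply/negP => il; apply: h4; exact: Bmono il _ h1.
  by rewrite leqNgt; apply/negP => il; apply: h2; exact: Bmono il _ h3.
have idx_gt x m : (m < idx x)%N -> x <> oo by move=> + xoo; rewrite xoo idx_oo.
exists lev; split.
- move=> i; apply: filterS (NB i) => x Bx.
  have [|xoo] := pselect (x = oo); [by left|right].
  have [_ h] := levP x xoo; rewrite leqNgt; apply/negP => il.
  by apply: h; exact: Bmono il _ Bx.
- move=> i m; have [_ [_ /(_ m)[x [mx Bx nB]]]] := BP i.
  by exists x => //; apply: levE => //; exact: idx_gt mx.
- move=> U /noU[n nP]; exists n.+1 => m; have [x [Ux mx nV]] := nP m.
  exists x; split=> //; have [h _] := levP x (idx_gt _ _ mx).
  rewrite ltnNge; apply/negP => nl; apply: nV.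
  have [[_ /(_ n (ltnSn n)) BW] _] := BP n.+1.
  by have [] := BW x (Bmono _ _ nl _ h).
Qed.

Section Fan.
Variable R : realType.
Variable lev : X -> nat.
Hypothesis levP : levels lev.
Implicit Types (s : seq nat).

(* On level [i < size s], [fan s] is [s_i] at the points of index at least [s_i] and [0]
   elsewhere: a non-zero value of a limit reveals [s_i], and an infinite strictly
   increasing [s] would give a function that is not continuous at [oo]. *)
Definition fan s (x : X) : R :=
  if (x != oo) && (lev x < size s)%N && (nth 0%N s (lev x) <= idx x)%N
  then (nth 0%N s (lev x))%:R else 0.

Lemma fan_eq s x : fan s x <> 0 ->
  [/\ x != oo, (lev x < size s)%N, (nth 0%N s (lev x) <= idx x)%N &
    fan s x = (nth 0%N s (lev x))%:R].
Proof. by rewrite /fan; case: ifP => // /andP[/andP[? ?] ?] _. Qed.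

Lemma fan_nat s x : exists k : nat, fan s x = k%:R.
Proof. by rewrite /fan; case: ifP => _; [exists (nth 0%N s (lev x))|exists 0%N]. Qed.

Lemma fan_oo s : fan s oo = 0. Proof. by rewrite /fan eqxx. Qed.

Lemma converges_fan s : converges oo N (fan s).
Proof.
have [h _ _] := levP; move=> r r0; apply: filterS (h (size s)) => x /= sx.
rewrite fan_oo (_ : fan s x = 0) ?subrr ?normr0// /fan.
case: sx => [->|]; first by rewrite eqxx.
by rewrite leqNgt => /negPf ->; rewrite andbF.
Qed.

Lemma path_nth_gt0 s i : path ltn 0%N s -> (i < size s)%N -> (0 < nth 0%N s i)%N.
Proof. by move=> /(order_path_min ltn_trans)/(all_nthP 0%N); apply. Qed.

Lemma path_nth_leq s i j : path ltn 0%N s -> (i <= j)%N -> (j < size s)%N ->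
  (nth 0%N s i <= nth 0%N s j)%N.
Proof.
move=> /path_sorted ps ij js; have ps' : sorted leq s.
  by apply: sub_sorted ps => a b; exact: ltnW.
by apply: (sorted_leq_nth leq_trans leqnn) => //; rewrite inE ?(leq_ltn_trans ij).
Qed.

(** An appended entry [m > n] affects only points of index at least [m], and the level [size s] has
    such points. *)
Lemma fan_crowded s n : path ltn 0%N s -> exists t,
  [/\ path ltn 0%N t, fan t <> fan s & forall x, (idx x <= n)%N -> fan s x = fan t x].
Proof.
move=> ps; pose m := (maxn n (last 0%N s)).+1.
exists (rcons s m); split.
- by rewrite rcons_path ps /m /= ltnS leq_maxr.
- have [_ /(_ (size s) m)[x xs mx] _] := levP.
  move=> /(congr1 (@^~ x)); rewrite /fan size_rcons xs nth_rcons !ltnn eqxx ltnS leqnn.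
  have -> : x != oo by apply: contraTneq mx => ->; rewrite idx_oo.
  by rewrite /= (ltnW mx) => /eqP; rewrite pnatr_eq0.
move=> x xn; rewrite /fan size_rcons nth_rcons ltnS.
case: (ltngtP (lev x) (size s)) => //= _; rewrite ?andbF//= ?andbT.
have /negPf -> : ~~ (m <= idx x)%N by rewrite -ltnNge ltnS (leq_trans xn)// leq_maxl.
by rewrite andbF.
Qed.

(** The values are natural numbers, so up to any index [f] agrees exactly with some [fan s].
    Non-zero values on all levels would contradict convergence at [oo]; so there is a first level
    [i] on which [f] vanishes, and the levels below it reveal the sequence. *)
Lemma fan_closed f : converges oo N f ->
  (forall n r, 0 < r -> exists2 s, path ltn 0%N s & close_upto idx n r f (fan s)) ->
  exists2 s, path ltn 0%N s & f = fan s.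
Proof.
move=> fc fcl.
have near x r : 0 < r -> exists k : nat, `|f x - k%:R| < r.
  move=> r0; have [s _ h] := fcl (idx x) r r0; have [k kE] := fan_nat s x.
  by exists k; rewrite -kE; apply: h.
have nat_dist (k l : nat) : `|k%:R - l%:R : R| < 1 -> k = l.
  move=> h; apply/eqP; rewrite eqn_leq -!(ler_nat R).
  apply/andP; split; rewrite leNgt; apply/negP; rewrite ltr_nat -(ler_nat R) -natr1;
    by move: h; move: (k%:R : R) (l%:R : R) => a b *; abs_lra.
have f_nat x : exists k : nat, f x = k%:R.
  have [k kx] := near x 2^-1 ltac:(lra); exists k; apply/eqP; rewrite -subr_eq0.
  apply: contrapT => /negP; rewrite -normr_gt0 => d0.
  have d2 : 0 < Num.min `|f x - k%:R| 2^-1 by rewrite lt_min d0; lra.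
  have [l] := near x _ d2; rewrite lt_min => /andP[l1 l2].
  suff kl : k = l by move: l1; rewrite kl ltxx.
  by apply: nat_dist; move: (f x) kx l2 {l1 d0 d2} => a *; abs_lra.
have agree n : exists2 s, path ltn 0%N s & forall x, (idx x <= n)%N -> f x = fan s x.
  have [s ps sP] := fcl n 1 ltr01; exists s => // x xn; have := sP x xn.
  by have [k ->] := f_nat x; have [l ->] := fan_nat s x => /nat_dist ->.
have foo : f oo = 0.
  by have [s _ ->] := agree 0%N; rewrite ?fan_oo ?idx_oo.
have [levN lev_inf lev_thick] := levP.
have [all_nz|/existsNP[i0 i0P]] := pselect (forall i, exists2 x, lev x = i & f x <> 0).
  have [U UP] : exists U : set X, N U /\ forall x, U x -> `|f x| < 1.
    by exists [set x | `|f x - f oo| < 1]; split=> [|x /=]; [exact: fc|rewrite foo subr0].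
  (* Take [x] in [U] of level below [n] and beyond the witnesses [z i] of all levels [i < n]. The
     entry revealed at [z (lev x)] is at most [idx x], so [f x] equals this entry, which is at least
     1, whereas [|f x| < 1] on [U]. *)
  have [n nP] := lev_thick U UP.1; have /choice[z zP] i : exists x, lev x = i /\ f x <> 0.
    by have [x ? ?] := all_nz i; exists x.
  have [x [/UP.2 fx xm xn]] := nP (\max_(i < n) idx (z i))%N.
  have zx : (idx (z (lev x)) <= idx x)%N.
    by rewrite (leq_trans _ (ltnW xm))// (leq_bigmax (Ordinal xn)).
  have [s ps sP] := agree (idx x).
  have [zl] := zP (lev x); rewrite sP// => /fan_eq[_]; rewrite zl => h1 h2 _.
  have := sP x (leqnn _); rewrite /fan h1 (leq_trans h2 zx).
  have -> : x != oo by apply: contraTneq xm => ->; rewrite idx_oo.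
  move=> /= fxE; move: fx; rewrite fxE normr_nat ltrn1.
  by rewrite ltnNge path_nth_gt0.
have [i [iz imin]] : exists i, (forall x, lev x = i -> f x = 0) /\
    forall j, (j < i)%N -> exists2 x, lev x = j & f x <> 0.
  have zeq j : ~ (exists2 x, lev x = j & f x <> 0) -> forall x, lev x = j -> f x = 0.
    by move=> nex x xj; apply: contrapT => fx; apply: nex; exists x.
  have exi : exists i, `[< forall x, lev x = i -> f x = 0 >].
    by exists i0; apply/asboolP; exact: zeq.
  have [i /asboolP iz imin] := ex_minnP exi; exists i; split=> // j ji.
  apply: contrapT => /zeq jz; have := imin j; rewrite leqNgt ji => h.
  by have : false by apply: h; apply/asboolP.
have /choice[z zP] j : exists x, (j < i)%N -> lev x = j /\ f x <> 0.
  have [/imin[x x1 x2]|ji] := pselect (j < i)%N; first by exists x.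
  by exists oo.
pose M := (\max_(j < i) idx (z j))%N.
have zM j : (j < i)%N -> (idx (z j) <= M)%N.
  by move=> ji; apply: (leq_bigmax (Ordinal ji)).
have entry s : (forall x, (idx x <= M)%N -> f x = fan s x) -> forall j, (j < i)%N ->
    (j < size s)%N /\ f (z j) = (nth 0%N s j)%:R.
  move=> sP j ji; have [zj] := zP j ji; rewrite (sP _ (zM j ji)) => /fan_eq[_].
  by rewrite zj => ? _.
have [s0 ps0 s0P] := agree M.
have size0 : (i <= size s0)%N.
  by rewrite leqNgt; apply/negP => /(entry s0 s0P)[]; rewrite ltnn.
exists (take i s0).
  by have := ps0; rewrite -{1}(cat_take_drop i s0) cat_path => /andP[].
apply/funext => p; apply: contrapT => fp.
(* This [x] on level [i] lies beyond [p]. If [p] has level at least [i] and [f p] is not 0, the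
   entry at [i] is at most the entry at [lev p], hence at most [idx x], and [f x] would not be 0
   either. *)
have [x xi xm] := lev_inf i (maxn M (idx p)).
move: xm; rewrite gtn_max => /andP[xM xp].
have [s ps sP] := agree (idx x).
have sM y : (idx y <= M)%N -> f y = fan s y.
  by move=> yM; apply: sP; rewrite (leq_trans yM)// ltnW.
have nths j : (j < i)%N -> nth 0%N s j = nth 0%N s0 j.
  move=> ji; have [_ h1] := entry s sM j ji; have [_ h2] := entry s0 s0P j ji.
  by apply/eqP; rewrite -(eqr_nat R) -h1 -h2.
have [pl|pl] := ltnP (lev p) i.
  apply: fp; rewrite sP ?(ltnW xp)// /fan size_takel// pl nth_take// nths//.
  by have [-> _] := entry s sM _ pl.
have tp : fan (take i s0) p = 0 by rewrite /fan size_takel// ltnNge pl andbF.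
move: fp; rewrite tp sP ?(ltnW xp)// => /fan_eq[_ p1 p2 _].
have is' : (i < size s)%N by exact: leq_ltn_trans p1.
have := iz x xi; rewrite sP// /fan xi is'.
have -> : x != oo by apply: contraTneq xM => ->; rewrite idx_oo.
rewrite (leq_trans (path_nth_leq ps pl p1)) ?(leq_trans p2 (ltnW xp))//= => /eqP.
by rewrite pnatr_eq0 gtn_eqF// path_nth_gt0.
Qed.

End Fan.
End Levels.

(** * Cylinder neighbourhoods *)

Lemma ptws_cvg (S : Type) (V : topologicalType) (F : set_system {ptws S -> V})
    (f : {ptws S -> V}) : Filter F ->
  (forall s A, nbhs (f s) A -> F [set g | A (g s)]) -> F --> f.
Proof.
move=> FF FA; apply/cvg_sup => s A [_ [[C oC <-] Cf] CA].
by apply: filterS CA _; apply: FA; exact: open_nbhs_nbhs.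
Qed.

Lemma ptws_eval_nbhs (S : Type) (V : topologicalType) (f : {ptws S -> V}) s A :
  nbhs (f s) A -> nbhs f [set g | A (g s)].
Proof.
have /cvg_sup/(_ s) cf : nbhs f --> f by exact: cvg_id.
by move=> fA; apply: cf; exact: (@initial_continuous _ _ (fun g : S -> V => g s) f).
Qed.

Section Cylinders.
Variables (S : Type) (idx : S -> nat).
Hypothesis idx_inj : injective idx.

Definition agree_upto n (chi chi' : S -> bool) := forall s, (idx s <= n)%N -> chi' s = chi s.

Lemma filter_below (T : Type) (F : set_system T) (FF : Filter F) (W : S -> set T) :
  (forall s, F (W s)) -> forall n, F [set t | forall s, (idx s <= n)%N -> W s t].
Proof.
move=> FW; have lvl i : F [set t | forall s, idx s = i -> W s t].
  have [[s si]|ns] := pselect (exists s, idx s = i).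
    by apply: filterS (FW s) => t Wt s'; rewrite -si => /idx_inj ->.
  by apply: filterS filterT => t _ s si; case: ns; exists s.
move=> n; apply: filterS (filter_leq FF lvl n) => t h s sn; exact: h sn _ erefl.
Qed.

Lemma nbhs_cantor (chi : {ptws S -> bool}) (U : set {ptws S -> bool}) :
  nbhs chi U <-> exists n, agree_upto n chi `<=` U.
Proof.
split=> [|[n nU]]; last first.
  apply: filterS nU _; apply: filter_below => s.
  exact: (@ptws_eval_nbhs _ _ chi s [set b | b = chi s]).
pose F := filter_from [set: nat] (fun n => agree_upto n chi).
have FF : Filter F.
  apply: filter_from_filter; first by exists 0%N.
  move=> i j _ _; exists (maxn i j) => // g h.
  by split=> s si; apply: h; rewrite leq_max si ?orbT.
suff : F --> chi by move=> Fchi /Fchi[n _ nU]; exists n.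
apply: ptws_cvg => s A /nbhs_singleton As; exists (idx s) => // g /(_ s (leqnn _)).
by rewrite /= => ->.
Qed.

Definition cylinder_nowhere_dense (K : set (S -> bool)) := forall chi n,
  exists chi' m, [/\ (n <= m)%N, agree_upto n chi chi' & forall g, agree_upto m chi' g -> ~ K g].

Lemma nowhere_denseP (K : set {ptws S -> bool}) :
  nowhere_dense K <-> cylinder_nowhere_dense K.
Proof.
split=> [Knd chi n|Knd].
  have [chi' [c' nK]] : exists chi' : {ptws S -> bool}, agree_upto n chi chi' /\ ~ closure K chi'.
    apply: contrapT => nex; suff : interior (closure K) (chi : {ptws S -> bool}) by rewrite Knd.
    apply/nbhs_cantor; exists n => chi' c'; apply: contrapT => nK.
    by apply: nex; exists chi'.
  have [U /existsNP[UN UK]] : exists U, ~ (nbhs chi' U -> K `&` U !=set0).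
    by apply/existsNP => h; exact: nK.
  have [UN' UK'] : nbhs chi' U /\ ~ (K `&` U !=set0) by [].
  have /nbhs_cantor[m mU] := UN'.
  exists chi', (maxn n m); split=> //; first exact: leq_maxl.
  move=> g gm Kg; apply: UK'; exists g; split=> //; apply: mU => s sm.
  by apply: gm; rewrite leq_max sm orbT.
apply/seteqP; split=> // chi /nbhs_cantor[n nK].
have [chi' [m [nm c' cK]]] := Knd chi n.
have [|g [Kg gm]] := nK chi' c' (agree_upto m chi'); last exact: cK g gm Kg.
by apply/nbhs_cantor; exists m.
Qed.

End Cylinders.

(** * Neighbourhoods, continuity and density in the function space, in terms of indices *)

Section FunctionSpace.
Variables (R : realType) (X : topologicalType) (oo : X) (idx : X -> nat).
Hypotheses (idx_inj : injective idx) (idx_oo : idx oo = 0%N).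
Hypothesis isolated_pts : forall x : X, x <> oo -> nbhs x [set x].

Local Notation Y := (Cp R X).

Definition cpval (f : Y) : X -> R := set_val f.

Lemma continuous_converges (f : X -> R) : continuous f <-> converges oo (nbhs oo) f.
Proof.
split=> [cf r r0|cf x].
  have /cvgrPdist_lt/(_ r r0) := cf oo; apply: filterS => x /=.
  by rewrite distrC.
apply/cvgrPdist_lt => r r0; have [->|xoo] := pselect (x = oo).
  by apply: filterS (cf r r0) => y /=; rewrite distrC.
by apply: filterS (isolated_pts xoo) => y ->; rewrite subrr normr0.
Qed.

Lemma cpval_converges f : converges oo (nbhs oo) (cpval f).
Proof. by apply/continuous_converges; exact: (set_valP f). Qed.

Lemma exists_cp f : converges oo (nbhs oo) f -> exists y : Y, cpval y = f.
Proof.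
by move=> /continuous_converges cf; exists (exist _ (f : {ptws X -> R}) (mem_set cf)).
Qed.

Lemma cpval_inj : injective cpval.
Proof. by move=> f g fg; exact: val_inj. Qed.

Lemma nbhs_cp (f : Y) (U : set Y) : nbhs f U <->
  exists n r, 0 < r /\ forall g, close_upto idx n r (cpval f) (cpval g) -> U g.
Proof.
split=> [|[n [r [r0 nU]]]]; last first.
  apply: filterS nU _; apply: filter_below => // x.
  have : continuous (set_val : Y -> {ptws X -> R}) by exact: initial_continuous.
  move=> /(_ f) cf; apply: (cf [set g : {ptws X -> R} | `|cpval f x - g x| < r]).
  apply: (@ptws_eval_nbhs _ _ _ x [set b : R | `|cpval f x - b| < r]).
  by apply: filterS (nbhsx_ballx (cpval f x) r r0) => b; rewrite -ball_normE.
pose F := filter_from [set p : nat * R | 0 < p.2]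
  (fun p => [set g : X -> R | close_upto idx p.1 p.2 (cpval f) g]).
have FF : Filter F.
  apply: filter_from_filter; first by exists (0%N, 1); rewrite /= ltr01.
  move=> [i r] [j q] /= r0 q0; exists (maxn i j, Num.min r q); first by rewrite /= lt_min r0.
  move=> g h; split=> x xi; have := h x; rewrite leq_max xi ?orbT /= => /(_ isT);
    by rewrite lt_min => /andP[].
have : F --> (cpval f : {ptws X -> R}).
  apply: ptws_cvg => x A /nbhs_ballP[r /= r0 rA]; exists (idx x, r) => // g /(_ x (leqnn _)).
  by move=> h; apply: rA; rewrite -ball_normE.
move=> Ff [_ [[B oB <-] Bf] BU].
have [|[n r] /= r0 nB] := Ff B; first exact: open_nbhs_nbhs.
by exists n, r; split=> // g gf; apply: BU; exact: nB.
Qed.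

Definition cp_continuous (h : Y -> Y) := forall f n r, 0 < r -> exists m q, 0 < q /\
  forall g, close_upto idx m q (cpval f) (cpval g) ->
    close_upto idx n r (cpval (h f)) (cpval (h g)).

Lemma cp_continuousP h : continuous h <-> cp_continuous h.
Proof.
split=> [hc f n r r0|hc f U].
  have /hc/nbhs_cp// : nbhs (h f) [set g | close_upto idx n r (cpval (h f)) (cpval g)].
  by apply/nbhs_cp; exists n, r.
move=> /nbhs_cp[n [r [r0 nU]]]; have [m [q [q0 mq]]] := hc f n r r0.
by apply/nbhs_cp; exists m, q; split=> // g /mq/nU.
Qed.

Lemma dense_cp (D : set Y) : dense D <-> forall (f : Y) n r, 0 < r ->
  exists2 g, D g & close_upto idx n r (cpval f) (cpval g).
Proof.
split=> [Dd f n r r0|Dd U [f Uf] oU].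
  have : nbhs f [set g | close_upto idx n r (cpval f) (cpval g)].
    by apply/nbhs_cp; exists n, r.
  rewrite nbhsE => -[U [oU Uf] UD]; have [|g [Ug Dg]] := Dd U _ oU; first by exists f.
  by exists g => //; exact: UD.
have /nbhs_cp[n [r [r0 nU]]] : nbhs f U by exact: open_nbhs_nbhs.
by have [g Dg fg] := Dd f n r r0; exists g; split=> //; exact: nU.
Qed.

End FunctionSpace.

(** * The function space of a space with one non-isolated point *)

Lemma countable_range_eq (T : Type) (D : set T) : countable D -> D !=set0 ->
  exists d : nat -> T, range d = D.
Proof.
move=> /countable_injP[f finj] [a Da].
have /choice[d dP] n : exists x, D x /\ forall y, D y -> f y = n -> y = x.
  have [[y Dy yn]|ny] := pselect (exists2 y, D y & f y = n); last first.
    by exists a; split=> // y Dy yn; case: ny; exists y.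
  by exists y; split=> // z Dz zn; apply: finj; rewrite ?inE// zn.
exists d; apply/seteqP; split=> [_ [n _ <-]|y Dy]; first exact: (dP n).1.
by exists (f y) => //; rewrite -((dP (f y)).2 y Dy erefl).
Qed.

Lemma countable_setU (T : Type) (A B : set T) : countable A -> countable B ->
  countable (A `|` B).
Proof.
move=> cA cB; have -> : A `|` B = \bigcup_b (if b then A else B).
  by apply/seteqP; split=> [x [Ax|Bx]|x [[] _ ?]]; [exists true|exists false|left|right].
by apply: bigcup_countable => [|[]] //; exact: countableP.
Qed.

Section PuncturedSpace.
Variables (R : realType) (X : topologicalType) (oo : X) (idx : X -> nat).
Hypotheses (idx_inj : injective idx) (idx_oo : idx oo = 0%N).
Hypothesis X_countable : countable [set: X].
Hypothesis isolated_pts : forall x : X, x <> oo -> nbhs x [set x].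
Hypothesis oo_limit : ~ nbhs oo [set oo].
Hypothesis tail : forall n, nbhs oo [set x | x = oo \/ (n < idx x)%N].

Local Notation Y := (Cp R X).
Local Notation S := (punctured oo).
Let idxS (s : S) : nat := idx (proj1_sig s).

Lemma punctured_inj (s t : S) : proj1_sig s = proj1_sig t -> s = t.
Proof.
by case: s t => [x p] [y q] /= xy; subst y; congr exist; exact: bool_irrelevance.
Qed.

Let idxS_inj : injective idxS.
Proof. by move=> s t /idx_inj/punctured_inj. Qed.

Lemma point_of_index (x : X) : x <> oo -> exists s : S, proj1_sig s = x.
Proof. by move=> /eqP xoo; exists (exist _ x xoo). Qed.

Lemma nbhd_filterP (A : set S) : nbhd_filter oo A <->
  nbhs oo [set x | forall s : S, proj1_sig s = x -> A s].
Proof.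
rewrite /nbhd_filter /=; split; apply: filterS => x /=.
  move=> [[s As <-] t /punctured_inj ->//|-> s soo].
  by have := proj2_sig s; rewrite soo eqxx.
move=> xA; have [->|xoo] := pselect (x = oo); first by right.
by left; have [s sx] := point_of_index xoo; exists s => //; exact: xA.
Qed.

Lemma nbhd_filter_proj (U : set X) : nbhs oo U -> nbhd_filter oo [set s : S | U (proj1_sig s)].
Proof. by move=> NU; apply/nbhd_filterP; apply: filterS NU => x Ux s sx; rewrite /= sx. Qed.

Lemma nbhd_filter_proper : ProperFilter (nbhd_filter oo).
Proof.
split.
  move=> /nbhd_filterP n0; apply: oo_limit; apply: filterS n0 => x xs.
  by apply: contrapT => /point_of_index[s /xs].
split.
- by apply/nbhd_filterP; apply: filterS filterT.
- move=> A B /nbhd_filterP NA /nbhd_filterP NB; apply/nbhd_filterP.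
  by apply: filterS2 NA NB => x xA xB s sx; split; [exact: xA|exact: xB].
- move=> A B AB /nbhd_filterP NA; apply/nbhd_filterP.
  by apply: filterS NA => x xA s sx; apply: AB; exact: xA.
Qed.

Lemma finite_bounded (A : set S) : finite_set A <-> exists m, forall s, A s -> (idxS s <= m)%N.
Proof.
split=> [|[m mP]].
  move=> /(finite_image idxS) /finite_seqP[l lP]; exists (\max_(i <- l) i)%N => s As.
  have : [set` l] (idxS s) by rewrite -lP; exists s.
  by move=> /= sl; apply: (leq_bigmax_seq (F := id) _ sl).
apply: (@sub_finite_set _ _ (idxS @^-1` `I_m.+1)).
  by move=> s /mP; rewrite /= ltnS.
apply: finite_preimage; last exact: finite_II.
by move=> s t _ _; exact: idxS_inj.
Qed.

Lemma P_filterP : is_P_filter (nbhd_filter oo) <-> has_pseudointersections idx (nbhs oo).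
Proof.
split=> [[_ PF] V NV|PN].
  have [|A /nbhd_filterP NA AV] := PF (fun n => [set s | V n (proj1_sig s)]).
    by move=> n; exact: nbhd_filter_proj.
  exists [set x | forall s : S, proj1_sig s = x -> A s] => // n.
  have [m mP] := (finite_bounded _).1 (AV n).
  exists m => x xA mx; have [|s sx] := @point_of_index x.
    by move=> xoo; move: mx; rewrite xoo idx_oo.
  apply: contrapT => nV; have := mP s; rewrite /idxS sx leqNgt mx => h.
  by have : false by apply: h; split; [exact: xA|rewrite /= sx].
split; first exact: nbhd_filter_proper.
move=> V NV.
have [n|U NU UV] := PN (fun n => [set x | forall s : S, proj1_sig s = x -> V n s]).
  exact/nbhd_filterP.
exists [set s | U (proj1_sig s)]; first exact: nbhd_filter_proj.
move=> n; have [m mP] := UV n; apply/finite_bounded; exists m => s [Us nV].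
by rewrite leqNgt; apply/negP => ms; apply: nV; exact: mP Us ms s erefl.
Qed.

(** If no member of the filter misses infinitely many blocks, each member meets all blocks from some
    [m] on and so lies in [F m]. The set [F m] is nowhere dense, since any finite pattern extends by
    zeros through a whole later block. *)
Lemma non_meager_misses_intervals :
  non_meager_family (nbhd_filter oo) -> misses_intervals idx (nbhs oo).
Proof.
move=> NM u uS; apply: contrapT => nA; apply: NM.
pose F m : set {ptws S -> bool} := [set chi | forall k, (m <= k)%N ->
  exists2 s, chi s & (u k < idxS s <= u k.+1)%N].
exists F; split=> [m|chi /nbhd_filterP NA].
  apply/(nowhere_denseP idxS_inj) => chi n; pose k := maxn m n.
  have nk : (n <= u k)%N by rewrite (leq_trans (leq_maxr m n))// increasing_geq.
  exists (fun s => (idxS s <= n)%N && chi s), (u k.+1); split.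
  - by rewrite (leq_trans nk)// ltnW.
  - by move=> s ->.
  move=> g gE /(_ k (leq_maxl _ _))[s gs /andP[s1 s2]].
  by move: gs; rewrite gE// leqNgt (leq_ltn_trans nk s1).
apply: contrapT => nF; apply: nA.
exists [set x | forall s : S, proj1_sig s = x -> chi s] => // m.
apply: contrapT => nk; apply: nF; exists m => // k mk.
apply: contrapT => ns; apply: nk; exists k => // x xA.
apply/negP => xk; apply: ns; have [|s sx] := @point_of_index x.
  by move=> xoo; move: xk; rewrite xoo idx_oo.
by exists s; [exact: xA|rewrite /idxS sx].
Qed.

Let step_cp_exists : exists mk : seq rat -> Y, forall c, cpval (mk c) = step_function R idx c.
Proof.
have /choice[mk mkE] (c : seq rat) : exists y : Y, cpval y = step_function R idx c.
  by apply: (exists_cp isolated_pts); exact: converges_step_function.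
by exists mk.
Qed.

Lemma step_cp_dense (mk : seq rat -> Y) :
  (forall c, cpval (mk c) = step_function R idx c) -> dense (range mk).
Proof.
move=> mkE; apply/(dense_cp idx_inj) => f n r r0.
have [c cP] := step_function_approx idx_inj idx_oo (cpval f) n r0.
exists (mk c); first by exists c.
by move=> x xn; rewrite mkE; exact: (cP x).1.
Qed.

Lemma countable_range_fun (C : countType) (T : Type) (f : C -> T) : countable (range f).
Proof. by apply: sub_countable (card_image_le _ _) (countableP _). Qed.

Lemma dense_inhabited (D : set Y) : dense D -> D !=set0.
Proof.
move=> /(dense_cp idx_inj) Dd; have [mk _] := step_cp_exists.
by have [g Dg _] := Dd (mk [::]) 0%N 1 ltr01; exists g.
Qed.

Lemma pseudointersections_cdh : has_pseudointersections idx (nbhs oo) ->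
  misses_intervals idx (nbhs oo) -> countable_dense_homogeneous Y.
Proof.
move=> PN NM; have [mk mkE] := step_cp_exists; split.
  by exists (range mk); split; [exact: countable_range_fun|exact: step_cp_dense].
have [x0 x0oo] : exists x0 : X, x0 != oo.
  apply: contrapT => nx; apply: oo_limit; apply: filterS filterT => x _.
  by apply: contrapT => /eqP xoo; apply: nx; exists x.
have seq_dense (d : nat -> Y) : dense (range d) ->
    dense_sequence oo idx (nbhs oo) (fun i => cpval (d i)).
  move=> /(dense_cp idx_inj) dd f fc n r r0; have [y <-] := exists_cp isolated_pts fc.
  by have [_ [i _ <-] h] := dd y n r r0; exists i.
move=> D E cD dD cE dE.
have [d dR] := countable_range_eq cD (dense_inhabited dD).
have [e eR] := countable_range_eq cE (dense_inhabited dE).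
rewrite -dR in dD *; rewrite -eR in dE *.
have conv (y : Y) : converges oo (nbhs oo) (cpval y) := cpval_converges isolated_pts y.
have [h [g [[[hK gK] hc gc hconv gconv] hd he]]] := dense_sequences_homeo idx_inj
  idx_oo x0oo tail NM PN (fun i => conv (d i)) (fun i => conv (e i))
  (seq_dense _ dD) (seq_dense _ dE).
have /choice[H HE] (y : Y) : exists z : Y, cpval z = h (cpval y).
  exact: (exists_cp isolated_pts (hconv _ (conv y))).
have /choice[G GE] (y : Y) : exists z : Y, cpval z = g (cpval y).
  exact: (exists_cp isolated_pts (gconv _ (conv y))).
exists H; split.
  exists G; split.
  - by move=> y; apply: cpval_inj; rewrite GE HE hK.
  - by move=> y; apply: cpval_inj; rewrite HE GE gK.
  - apply/(cp_continuousP idx_inj) => f n r r0; have [m [q [q0 mq]]] := hc (cpval f) n r r0.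
    by exists m, q; split=> // z /mq; rewrite !HE.
  - apply/(cp_continuousP idx_inj) => f n r r0; have [m [q [q0 mq]]] := gc (cpval f) n r r0.
    by exists m, q; split=> // z /mq; rewrite !GE.
apply/seteqP; split=> [_ [_ [i _ <-] <-]|_ [j _ <-]].
  have [j ij] := hd i; exists j => //; apply: cpval_inj; rewrite HE; exact: esym.
have [i ij] := he j; exists (d i); first by exists i.
by apply: cpval_inj; rewrite HE.
Qed.

(** A homeomorphism taking the fans and step functions together onto the step functions sends the
    fans to a crowded set of eventually constant functions. [escaping_limit] yields a limit of this
    set outside it, whose preimage is again a fan by [fan_closed], a contradiction. *)
Lemma cdh_pseudointersections : misses_intervals idx (nbhs oo) ->
  countable_dense_homogeneous Y -> has_pseudointersections idx (nbhs oo).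
Proof.
move=> NM [_ cdh]; apply: contrapT => /(levels_exist idx_oo tail)[lev levP].
have [mk mkE] := step_cp_exists.
have /choice[phi phiE] (s : seq nat) : exists y : Y, cpval y = fan oo idx R lev s.
  by apply: (exists_cp isolated_pts); exact: converges_fan.
pose Q := [set phi s | s in [set s | path ltn 0%N s]].
have cQ : countable Q by apply: sub_countable (card_image_le _ _) (countableP _).
have dQ : dense (Q `|` range mk).
  apply/(dense_cp idx_inj) => f n r r0.
  have [g gm fg] := (dense_cp idx_inj _).1 (step_cp_dense mkE) f n r r0.
  by exists g => //; right.
have [h [[k [hK kK hc kc]] hQ]] := cdh _ _ (countable_setU cQ (countable_range_fun mk)) dQ
  (countable_range_fun mk) (step_cp_dense mkE).
move: hc kc => /(cp_continuousP idx_inj) hc /(cp_continuousP idx_inj) kc.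
(* The empty sequence stands in for unsuitable codes, so [enum] lists exactly the positive strictly
   increasing sequences. *)
pose enum i := if unpickle i is Some s then (if path ltn 0%N s then s else [::]) else [::].
have enumP i : path ltn 0%N (enum i) by rewrite /enum; case: unpickle => // s; case: ifP.
have enumK s : path ltn 0%N s -> exists i, enum i = s.
  by move=> ps; exists (pickle s); rewrite /enum pickleK ps.
pose q i := cpval (h (phi (enum i))).
have q_tail i : exists n, forall x, (n < idx x)%N -> q i x = q i oo.
  have [c _ cE] : range mk (h (phi (enum i))).
    by rewrite -hQ; exists (phi (enum i)) => //; left; exists (enum i) => //; exact: enumP.
  exists (size c) => x /ltnW cx; rewrite /q -cE mkE.
  exact: step_function_tail.
have q_crowded i n r : 0 < r -> exists2 j, q j <> q i & close_upto idx n r (q i) (q j).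
  move=> r0; have [m [p [p0 mp]]] := hc (phi (enum i)) n r r0.
  have [t [pt tn ti]] := fan_crowded idx_oo R levP m (enumP i).
  have [j jt] := enumK t pt; exists j.
    move=> /cpval_inj/(can_inj hK) /(congr1 (@cpval R X)); rewrite !phiE jt.
    exact: tn.
  by apply: mp => x xm; rewrite !phiE jt ti// subrr normr0.
have [f [fc fq nf]] := escaping_limit idx_oo tail q_tail q_crowded NM.
have [y yE] := exists_cp isolated_pts fc.
have [|s ps sE] := fan_closed idx_oo levP (cpval_converges isolated_pts (k y)).
  move=> n r r0; have [m [p [p0 mp]]] := kc y n r r0.
  have [i iP] := fq m p p0; exists (enum i) => //.
  have := mp (h (phi (enum i))); rewrite yE hK phiE; exact.
have [i iE] := enumK s ps; apply: (nf i); rewrite /q iE -yE; congr cpval.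
by rewrite -[LHS]kK; congr h; apply: cpval_inj; rewrite phiE.
Qed.

(* Perturbing [f] so that no distance [|f x - f oo|] equals [1] forces the values
   on indices at most [n] of every [chi] compatible with a function close to [f]. *)
Lemma avoid_compatible (K : set (S -> bool)) : cylinder_nowhere_dense idxS K ->
  forall (f : Y) n r, 0 < r -> exists (f' : Y) m q, 0 < q /\
    forall g : Y, close_upto idx m q (cpval f') (cpval g) ->
      close_upto idx n r (cpval f) (cpval g) /\
      ~ exists2 chi, K chi & forall s : S,
        (chi s -> `|cpval g (proj1_sig s) - cpval g oo| <= 1) /\
        (~~ chi s -> 1 <= `|cpval g (proj1_sig s) - cpval g oo|).
Proof.
move=> Knd y n r r0; set f := cpval y.
(* The constants [c] for which raising all values off [oo] by [c] could produce a difference 1 or -1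
   with [f oo]. *)
pose bad := [set 1 - (f x - f oo) | x in [set: X]] `|` [set - 1 - (f x - f oo) | x in [set: X]].
have cbad : countable bad.
  by apply: countable_setU; apply: sub_countable (card_image_le _ _) X_countable.
have r2 : 0 < r / 2 by lra.
have [c [c0 cr cbadN]] := interval_avoid_countable cbad r2.
pose f1 x := f x + (if x == oo then 0 else c).
have f1oo : f1 oo = f oo by rewrite /f1 eqxx addr0.
have f1N x : x <> oo -> `|f1 x - f1 oo| != 1.
  move=> /eqP xoo; rewrite f1oo /f1 (negPf xoo); apply/eqP => e1; apply: cbadN.
  by case: (ger0P (f x + c - f oo)) e1 => _ e1; [left|right]; exists x => //; lra.
(* Starting from the pattern that [f1] forces up to [n], nowhere density gives a pattern [chi'] up
   to [m] with no extension in [K]. *)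
have [chi' [m [nm c' cK]]] := Knd (fun s => `|f1 (proj1_sig s) - f1 oo| <= 1) n.
pose on x := `[< exists s : S, proj1_sig s = x /\ chi' s >].
(* Between [n] and [m] the distance to [f oo] is 0 or 2, on the side of 1 that [chi'] prescribes;
   beyond [m] the constant value gives convergence. *)
pose f2 x := if (idx x <= n)%N then f1 x else
  if (m < idx x)%N || on x then f oo else f oo + 2.
have f2oo : f2 oo = f oo by rewrite /f2 idx_oo leq0n f1oo.
have f2c : converges oo (nbhs oo) f2.
  move=> e e0; apply: filterS (tail m) => x /= [->|mx]; first by rewrite subrr normr0.
  by rewrite f2oo /f2 leqNgt (leq_ltn_trans nm mx) mx /= subrr normr0.
have [y2 y2E] := exists_cp isolated_pts f2c.
have [k kP] : exists k : nat, forall i, (i <= n)%N -> forall x, idx x = i -> x <> oo ->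
    k.+1%:R^-1 <= `| `|f1 x - f1 oo| - 1|.
  apply: (@uniform_bound (fun i k => forall x, idx x = i -> x <> oo ->
    k.+1%:R^-1 <= `| `|f1 x - f1 oo| - 1|)) => [i k k' kk h x xi xoo|i].
    apply: le_trans (h x xi xoo).
    by rewrite lef_pV2 ?posrE ?ltr0n// ler_nat ltnS.
  have [[x xi xoo]|nx] := pselect (exists2 x, idx x = i & x <> oo); last first.
    by exists 0%N => x xi xoo; case: nx; exists x.
  have d0 : 0 < `| `|f1 x - f1 oo| - 1| by rewrite normr_gt0 subr_eq0 f1N.
  have [k kP] := invS_lt d0; exists k => z; rewrite -xi => /idx_inj -> _.
  exact/ltW/kP.
have kap : 0 < (k.+1%:R : R)^-1 by rewrite invr_gt0.
move: (k.+1%:R^-1 : R) kap kP => kap kap0 kP.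
(* Two errors below [q] change [|f2 x - f2 oo|] by less than [kap] up to [n] and by less than 1
   between [n] and [m], hence never carry it across 1. *)
pose q := Num.min (r / 2) (Num.min (kap / 2) 2^-1).
have q0 : 0 < q by rewrite !lt_min; apply/and3P; split; lra.
exists y2, m, q; split=> // g; rewrite y2E => yg.
have gq x : (idx x <= m)%N -> [/\ `|f2 x - cpval g x| < r / 2,
    `|f2 x - cpval g x| < kap / 2 & `|f2 x - cpval g x| < 2^-1].
  by move=> /yg; rewrite !lt_min => /and3P[].
have [_ goo1 goo2] := gq oo ltac:(by rewrite idx_oo); rewrite f2oo in goo1 goo2.
split=> [x xn|[chi Kchi chiP]].
  have [h _ _] := gq x (leq_trans xn nm); rewrite -/f.
  have : `|f x - f1 x| < r / 2.
    rewrite /f1; case: ifP => _; first by rewrite addr0 subrr normr0.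
    by rewrite opprD addrA subrr sub0r normrN gtr0_norm.
  by move: h; rewrite /f2 xn => *; abs_lra.
apply: (cK chi _ Kchi) => s; rewrite /idxS.
have := proj2_sig s; have := chiP s; have chi'E : on (proj1_sig s) = chi' s.
  apply/asboolP/idP => [[t [/punctured_inj -> //]]|h]; by exists s.
move: (c' s) chi'E; rewrite /idxS; set x := proj1_sig s => c's chi'E [ch1 ch2] /eqP xoo xm.
have [_ h1 h2] := gq x xm.
have [xn|xn] := leqP (idx x) n.
  rewrite (c's xn); have := kP _ xn x erefl xoo; rewrite f1oo.
  move: h1; rewrite /f2 xn => h1 h3.
  have h4 : `| `|f1 x - f oo| - `|cpval g x - cpval g oo| | < kap.
    by rewrite (le_lt_trans (ler_dist_dist _ _))//; abs_lra.
  move: h3 h4 ch1 ch2; move: `|f1 x - f oo| `|cpval g x - cpval g oo| => a b.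
  rewrite ltr_norml => h3 /andP[h4 h5] ch1 ch2.
  case: (leP a 1) h3 => a1 h3; apply/idP.
    rewrite ler0_norm ?subr_le0// in h3.
    by apply: contraT => /ch2 b1; exfalso; lra.
  rewrite gtr0_norm ?subr_gt0// in h3.
  by move=> /ch1 b1; lra.
move: h2; rewrite /f2 leqNgt xn /= ltnNge xm /= chi'E.
case: (chi' s) => h2; apply/idP.
  by apply: contraT => /ch2; apply: contraTT => _; rewrite -ltNge; abs_lra.
move=> /ch1; apply/negP; rewrite -ltNge.
by apply: lt_le_trans (ler_norm _); split_abs; lra.
Qed.

Lemma Baire_real (O : nat -> set R) : (forall i, open (O i)) ->
  (forall i (a b : R), a < b -> exists r, [/\ a < r, r < b & O i r]) ->
  exists r, forall i, O i r.
Proof.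
move=> oO dO; have /(_ setT) : dense (\bigcap_i (O i : set R^o)).
  apply: Baire => i; split; first exact: oO.
  move=> U [u Uu] oU; have /nbhs_ballP[e /= e0 eU] : nbhs u U by exact: open_nbhs_nbhs.
  have [r [r1 r2 Or]] := dO i (u - e) (u + e) ltac:(lra).
  exists r; split=> //; apply: eU; rewrite -ball_normE /=.
  by rewrite ltr_norml; apply/andP; split; lra.
case=> [||r [_ rO]]; [by exists 0|exact: openT|].
by exists r => i; exact: rO.
Qed.

Lemma cdh_non_meager : countable_dense_homogeneous Y -> non_meager_family (nbhd_filter oo).
Proof.
move=> [_ cdh] [K [Knd Kcov]]; have [mk mkE] := step_cp_exists.
(* The sets [T i] cover the space: each [g] is compatible with the set where [|g - g oo| <= 1], a
   member of the filter and therefore of some [K i]. *)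
pose T i (g : Y) := exists2 chi, K i chi & forall s : S,
  (chi s -> `|cpval g (proj1_sig s) - cpval g oo| <= 1) /\
  (~~ chi s -> 1 <= `|cpval g (proj1_sig s) - cpval g oo|).
have T_cover (g : Y) : exists i, T i g.
  pose chi (s : S) := `|cpval g (proj1_sig s) - cpval g oo| <= 1.
  have : as_subset_of_cantor (nbhd_filter oo) chi.
    apply: (@nbhd_filter_proj [set x | `|cpval g x - cpval g oo| <= 1]).
    by apply: filterS (cpval_converges isolated_pts g ltr01) => x /ltW.
  move=> /Kcov[i _ Kchi]; exists i, chi => // s.
  by rewrite /chi; split=> //; rewrite -ltNge => /ltW.
have T_avoid i : forall (f : Y) n r, 0 < r -> exists (f' : Y) m q, 0 < q /\
    forall g : Y, close_upto idx m q (cpval f') (cpval g) ->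
      close_upto idx n r (cpval f) (cpval g) /\ forall j, (j <= i)%N -> ~ T j g.
  elim: i => [|i IH] f n r r0.
    have [f' [m [q [q0 mq]]]] := avoid_compatible ((nowhere_denseP idxS_inj _).1 (Knd 0%N)) f n r0.
    exists f', m, q; split=> // g /mq[h1 h2]; split=> // j.
    by rewrite leqn0 => /eqP ->.
  have [f1 [m1 [q1 [q10 mq1]]]] := IH f n r r0.
  have [f' [m [q [q0 mq]]]] :=
    avoid_compatible ((nowhere_denseP idxS_inj _).1 (Knd i.+1)) f1 m1 q10.
  exists f', m, q; split=> // g /mq[/mq1[h1 h2] h3]; split=> // j.
  by rewrite leq_eqVlt => /predU1P[->|/h2].
(* A code gives a step function, an index bound and a precision. The point [d i] realises this
   approximation and has a neighbourhood missing [T 0, ..., T i]. *)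
pose code i : seq rat * nat * nat := odflt ([::], 0%N, 0%N) (unpickle i).
have /choice[d dP] i : exists d : Y,
    close_upto idx (code i).1.2 (code i).2.+1%:R^-1 (cpval (mk (code i).1.1)) (cpval d) /\
    exists m q, 0 < q /\ forall g, close_upto idx m q (cpval d) (cpval g) ->
      forall j, (j <= i)%N -> ~ T j g.
  have gap : 0 < ((code i).2.+1%:R : R)^-1 by rewrite invr_gt0.
  have [d [m [q [q0 mq]]]] := T_avoid i (mk (code i).1.1) (code i).1.2 _ gap.
  exists d; split; last by exists m, q; split=> // g /mq[].
  by apply: (mq d _).1 => x _; rewrite subrr normr0.
have dd : dense (range d).
  apply/(dense_cp idx_inj) => f n r r0; have r2 : 0 < r / 2 by lra.
  have [c cP] := step_function_approx idx_inj idx_oo (cpval f) n r2.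
  have [k kP] := invS_lt r2; have kr := kP k (leqnn k).
  pose i := pickle (c, n, k); exists (d i); first by exists i.
  have [+ _] := dP i; rewrite /code pickleK /= mkE => cd x xn.
  have := cd x xn; have := (cP x).1 xn; move: (k.+1%:R^-1 : R) kr => z kr *.
  by abs_lra.
have dE : dense (range d `|` range mk).
  apply/(dense_cp idx_inj) => f n r r0.
  have [g gd fg] := (dense_cp idx_inj _).1 dd f n r r0.
  by exists g => //; left.
have [h [[k [hK kK _ kc]] hd]] := cdh _ _ (countable_range_fun d) dd
  (countable_setU (countable_range_fun d) (countable_range_fun mk)) dE.
move: kc => /(cp_continuousP idx_inj) kc.
have /choice[cst cstE] (r : R) : exists y : Y, cpval y = fun=> r.
  apply: (exists_cp isolated_pts) => e e0; apply: filterS filterT => x _ /=.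
  by rewrite subrr normr0.
have cst_inj r r' : k (cst r) = k (cst r') -> r = r'.
  move=> /(can_inj kK)/(congr1 (@cpval R X)); rewrite !cstE.
  by move=> /(congr1 (@^~ oo)).
have cst_rat (p : rat) : exists i, k (cst (ratr p)) = d i.
  have [_ [i _ <-] e] : [set h x | x in range d] (cst (ratr p)).
    rewrite hd; right; exists [:: p] => //; apply: cpval_inj; rewrite mkE cstE.
    apply/funext => x; rewrite /step_function /=.
    by case: (idx x) => //= i; rewrite nth_nil.
  by exists i; rewrite -e hK.
(* The parameters near which the line of constants, carried by [k], misses [T i]; a common element
   of all [O i] contradicts the covering by the [T i]. *)
pose O i : set R := [set r | exists2 e, 0 < e & forall r', `|r - r'| < e -> ~ T i (k (cst r'))].
have [i|i a b ab|r rO] := @Baire_real O.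
- rewrite openE => r [e e0 rP]; apply/nbhs_ballP; exists (e / 2); first by rewrite /= divr_gt0.
  move=> r' /=; rewrite -ball_normE /= => rr'; exists (e / 2); first by rewrite divr_gt0.
  by move=> r'' r'r''; apply: rP; abs_lra.
(* Only the [d j] with [j < i] may lack a neighbourhood missing [T i]. The injective line passes
   through each at most once, so a subinterval avoids them; [k] sends its rational constants to
   later [d l], hence its rationals lie in [O i]. *)
- have [a' [b' [aa' ab' b'b avoid]]] : exists a' b', [/\ a <= a', a' < b', b' <= b &
      forall r, a' < r -> r < b' -> forall j, (j < i)%N -> k (cst r) <> d j].
    elim: i => [|i [a' [b' [h1 h2 h3 h4]]]]; first by exists a, b.
    have [[t [t1 t2 td]]|nt] := pselect (exists t, [/\ a' < t, t < b' & k (cst t) = d i]).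
      exists t, b'; split=> //; first by rewrite (le_trans h1)// ltW.
      move=> r tr rb j; rewrite ltnS leq_eqVlt => /predU1P[->|].
        by rewrite -td => /cst_inj rt; move: tr; rewrite rt ltxx.
      exact: h4 (lt_trans t1 tr) rb j.
    exists a', b'; split=> // r r1 r2 j; rewrite ltnS leq_eqVlt => /predU1P[-> rd|].
      by apply: nt; exists r.
    exact: h4.
  have [p] := rat_in_itvoo ab'; rewrite in_itv /= => /andP[p1 p2].
  exists (ratr p); split; [exact: le_lt_trans p1|exact: lt_le_trans b'b|].
  have [l lE] := cst_rat p; have [_ [m [q [q0 mq]]]] := dP l.
  have il : (i <= l)%N by rewrite leqNgt; apply/negP => /(avoid _ p1 p2)/(_ lE).
  have [m' [e [e0 mq']]] := kc (cst (ratr p)) m q q0.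
  exists e => // r' pr'; apply: (mq _ _ _ il); rewrite -lE; apply: mq' => x _.
  by rewrite !cstE.
have [i Ti] := T_cover (k (cst r)).
by have [e e0 /(_ r)] := rO i; rewrite subrr normr0 => /(_ e0).
Qed.

End PuncturedSpace.

(** * From the topological hypotheses to an indexed space *)

Theorem mainTheorem1 (R : realType) (X : topologicalType) (oo : X) :
  countable [set: X] ->
  tychonoff_space X ->
  ~ isolated [set: X] oo ->
  (forall x : X, x <> oo -> isolated [set: X] x) ->
  (countable_dense_homogeneous (Cp R X) <->
   (non_meager_family (nbhd_filter oo) /\ is_P_filter (nbhd_filter oo))).
Proof.
move=> cX [T1 _] ooN isoX.
have iso x : x <> oo -> nbhs x [set x].
  by move=> /isoX[_ [V Vx]]; rewrite setIT => <-.
have ooN' : ~ nbhs oo [set oo].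
  by move=> h; apply: ooN; split; [rewrite inE|exists [set oo] => //; rewrite setIT].
have [f0 f0_inj] := countable_injP _ cX.
(* The shift by one reserves the index 0 for [oo]. *)
pose idx x := if x == oo then 0%N else (f0 x).+1.
have idx_inj : injective idx.
  move=> x y; rewrite /idx; case: eqP => [->|_]; case: eqP => [->|_] // [].
  by apply: f0_inj; rewrite inE.
have idx_oo : idx oo = 0%N by rewrite /idx eqxx.
have tail n : nbhs oo [set x | x = oo \/ (n < idx x)%N].
  have single x : nbhs oo [set z | x != oo -> z <> x].
    have [->|xoo] := eqVneq x oo; first by apply: filterS filterT => z _ /eqP.
    have [A [oA /set_mem Aoo /set_mem Ax]] := T1 oo x ltac:(by rewrite eq_sym).
    apply: filterS (open_nbhs_nbhs (conj oA Aoo)) => z Az _ zx.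
    by apply: Ax; rewrite -zx.
  apply: filterS (filter_below idx_inj _ single n) => z zn.
  have [->|zoo] := eqVneq z oo; [by left|right].
  by rewrite ltnNge; apply/negP => /zn/(_ zoo).
split=> [cdh|[NM /(P_filterP idx_inj idx_oo ooN') PN]].
  have NM := cdh_non_meager idx_inj idx_oo cX iso tail cdh; split=> //.
  apply/(P_filterP idx_inj idx_oo ooN').
  apply: cdh_pseudointersections cdh => //.
  exact: non_meager_misses_intervals.
apply: pseudointersections_cdh PN _ => //; exact: non_meager_misses_intervals.
Qed.
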